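(* Let $M=G/K$ be one of the irreducible Riemannian symmetric spaces of noncompact type whose restricted root system is of type $D$, i.e. $M=\mathrm{SO}(2j,\mathbb C)/\mathrm{SO}(2j)$ ($j\ge 4$) or $M=\mathrm{SO}_o(p,p)/(\mathrm{SO}(p)\times\mathrm{SO}(p))$ ($p\ge4$). Then there exists an involution (involutive automorphism) $\widetilde\sigma:G\to G$ such that 1. $d\widetilde\sigma|_{\mathfrak a}=\sigma$; 2. $\widetilde\sigma$ commutes with the Cartan involution $\theta$, and in particular $\widetilde\sigma(K)=K$; 3. $\widetilde\sigma(N)=N$.
   Context: $\theta$ is the Cartan involution of $G$ with fixed point group $K$, $\mathfrak g=\mathfrak k\oplus\mathfrak s$ the corresponding decomposition, $\mathfrak a\subset\mathfrak s$ a maximal abelian subspace, $\Sigma(\mathfrak g,\mathfrak a)\subset \mathfrak a^*$ the set of restricted roots with a fixed positive system $\Sigma^+$, $\mathfrak n=\bigoplus_{\alpha\in\Sigma^+}\mathfrak g_\alpha$, and $N$ the analytic subgroup of $G$ with Lie algebra $\mathfrak n$. The simple roots $\alpha_1,\dots,\alpha_r$ are numbered so that $\alpha_1,\alpha_2$ are the two end nodes of the fork of the Dynkin diagram $D_r$, both attached to $\alpha_3$. $\sigma$ is the linear involution of $\mathfrak a$ (and of $\mathfrak a^*$) induced by the nontrivial diagram automorphism $\sigma(\alpha_1)=\alpha_2$, $\sigma(\alpha_2)=\alpha_1$, $\sigma(\alpha_i)=\alpha_i$ for $i\ge3$.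
   Formalization: For rank 4 (j=4 or p=4), where D_4 has three end nodes at α_3, α_1 and α_2 are required to be the classical fork e_3−e_4, e_3+e_4, i.e. (α_1−α_2)/2 is a weight of the defining representation; for the other pairs the claim fails for SO(8,C) and SO_o(4,4). *)

(* Defs.v *)
From HB Require Import structures.
From mathcomp Require Import all_boot all_order all_algebra.
From mathcomp Require Import all_classical all_reals all_analysis.
From mathcomp Require Export complex.
Set Implicit Arguments.
Unset Strict Implicit.
Unset Printing Implicit Defensive.
Import Order.TTheory GRing.Theory Num.Theory.
Import numFieldNormedType.Exports.
Local Open Scope classical_set_scope.
Local Open Scope ring_scope.

(* Lie groups are closed groups of n x n matrices over F, where F is R itself
   or R[i], and iota : R -> F is the inclusion of the real scalars.  All Lie
   algebras are *real* Lie algebras of matrices; they are given as sets of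
   matrices. *)

Definition expmx {F : numFieldType} {n : nat} (X : 'M[F]_n) : 'M[F]_n :=
  lim ((\sum_(0 <= k < m) (k`!%:R : F)^-1 *: X ^+ k) @[m --> \oo]).

Definition lie_bracket (F : numFieldType) (n : nat) (X Y : 'M[F]_n) : 'M[F]_n :=
  X *m Y - Y *m X.

Section RealLie.
Context (R : realType) (F : numFieldType) (iota : {rmorphism R -> F}) (n : nat).
Implicit Types (G : set 'M[F]_n) (X Y H : 'M[F]_n).
Implicit Types (f theta : 'M[F]_n -> 'M[F]_n) (alpha beta : 'M[F]_n -> R).
Implicit Types (g s a V S : set 'M[F]_n).

Definition real_subspace V : Prop :=
  V 0 /\ forall (t : R) X Y, V X -> V Y -> V (iota t *: X + Y).

Definition real_span S : set 'M[F]_n :=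
  [set X | forall V, real_subspace V -> S `<=` V -> V X].

Definition lie_algebra G : set 'M[F]_n :=
  [set X | forall t : R, G (expmx (iota t *: X))].

Definition is_subgroup G : Prop :=
  [/\ G 1%:M, forall A B, G A -> G B -> G (A *m B)
    & forall A, G A -> A \in unitmx /\ G (invmx A)].

(* The analytic (connected Lie) subgroup with Lie algebra V is the group
   generated by the exponentials of elements of V. *)
Definition analytic_subgroup V : set 'M[F]_n :=
  [set A | forall G, is_subgroup G -> expmx @` V `<=` G -> G A].

(* (df) X = Y, for the differential of f at the identity:
   Y is the derivative at t = 0 of t |-> f (exp (t X)), where f 1 = 1. *)
Definition differential_at1 f X Y : Prop :=
  ((iota t)^-1 *: (f (expmx (iota t *: X)) - 1%:M)) @[t --> (0 : R)^'] --> Y.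

(* A continuous homomorphism of Lie groups is automatically analytic.  Only
   the values of f on G matter. *)
Definition involutive_automorphism G f : Prop :=
  [/\ forall A, G A -> G (f A),
      forall A B, G A -> G B -> f (A *m B) = f A *m f B,
      forall A, G A -> f (f A) = A
    & {within G, continuous f}].

(* The (-1)-eigenspace of d theta on the Lie algebra of G. *)
Definition cartan_s G theta : set 'M[F]_n :=
  [set X | lie_algebra G X /\ differential_at1 theta X (- X)].

Definition abelian_subspace V : Prop :=
  real_subspace V /\ forall X Y, V X -> V Y -> lie_bracket X Y = 0.

Definition maximal_abelian_in s a : Prop :=
  [/\ abelian_subspace a, a `<=` s
    & forall b, abelian_subspace b -> b `<=` s -> a `<=` b -> b = a].

(* An element of the dual of a is represented by a function on matrices that is
   linear on a; two such functions are identified when they agree on a. *)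
Definition dual a : set ('M[F]_n -> R) :=
  [set alpha | forall (t : R) X Y, a X -> a Y ->
     alpha (iota t *: X + Y) = t * alpha X + alpha Y].

Definition eq_dual a alpha beta : Prop := forall H, a H -> alpha H = beta H.

Definition root_space g a alpha : set 'M[F]_n :=
  [set X | g X /\ forall H, a H -> lie_bracket H X = iota (alpha H) *: X].

Definition restricted_roots g a : set ('M[F]_n -> R) :=
  [set alpha | [/\ dual a alpha, ~ eq_dual a alpha (fun=> 0)
     & exists2 X, root_space g a alpha X & X != 0]].

(* The roots that are positive on some regular element of a (equivalently, on
   some Weyl chamber). *)
Definition positive_system g a (P : set ('M[F]_n -> R)) : Prop :=
  exists H0, [/\ a H0,
    forall alpha, restricted_roots g a alpha -> alpha H0 != 0
    & P = [set alpha | restricted_roots g a alpha /\ 0 < alpha H0]].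

Definition iwasawa_n g a (P : set ('M[F]_n -> R)) : set 'M[F]_n :=
  real_span (\bigcup_(alpha in P) root_space g a alpha).

Definition simple_root a (P : set ('M[F]_n -> R)) alpha : Prop :=
  P alpha /\ ~ exists beta gamma,
    [/\ P beta, P gamma & eq_dual a alpha (fun H => beta H + gamma H)].

(* alpha 1, ..., alpha r are the simple roots, each listed once. *)
Definition simple_root_numbering a (P : set ('M[F]_n -> R)) (r : nat)
    (alpha : nat -> 'M[F]_n -> R) : Prop :=
  [/\ forall i, (1 <= i <= r)%N -> simple_root a P (alpha i),
      forall i j, (1 <= i <= r)%N -> (1 <= j <= r)%N ->
        eq_dual a (alpha i) (alpha j) -> i = j
    & forall beta, simple_root a P beta ->
        exists2 i, (1 <= i <= r)%N & eq_dual a beta (alpha i)].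

(* The trace form of the defining representation is, on so(m,C) and so(p,q), a
   positive multiple of the Killing form up to taking real parts; it is real on
   a, and Cartan integers do not depend on the scale. *)
Definition dual_vector a alpha : 'M[F]_n :=
  get [set h | a h /\ forall H, a H -> \tr (h *m H) = iota (alpha H)].

Definition inner_dual a alpha beta : F :=
  \tr (dual_vector a alpha *m dual_vector a beta).

Definition cartan_integer a alpha beta : F :=
  2 * inner_dual a alpha beta / inner_dual a beta beta.

Definition D_edge (i j : nat) : bool :=
  let m := minn i j in let M := maxn i j in
  ((m == 1) && (M == 3))%N || ((2 <= m) && (M == m.+1))%N.

Definition D_cartan_matrix (i j : nat) : int :=
  if i == j then 2 else if D_edge i j then -1 else 0.

Definition D_diagram a (r : nat) (alpha : nat -> 'M[F]_n -> R) : Prop :=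
  forall i j, (1 <= i <= r)%N -> (1 <= j <= r)%N ->
    cartan_integer a (alpha i) (alpha j) = (D_cartan_matrix i j)%:~R.

Definition defining_weight a beta : Prop :=
  exists2 v : 'cV[F]_n, v != 0 & forall H, a H -> H *m v = iota (beta H) *: v.

(* For r >= 5 the Dynkin diagram determines alpha 1 and alpha 2 up to order.
   D_4 has three end nodes attached to alpha 3; the fork of the classical
   D_4-diagram consists of e_3 - e_4 and e_3 + e_4, where +-e_1, ..., +-e_4 are
   the weights of a on the defining representation.  The other two pairs are
   obtained by triality, which does not descend to the groups SO(8,C) and
   SO_o(4,4). *)
Definition D_numbering a (P : set ('M[F]_n -> R)) (r : nat)
    (alpha : nat -> 'M[F]_n -> R) : Prop :=
  [/\ simple_root_numbering a P r alpha, D_diagram a r alpha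
    & r = 4%N -> defining_weight a (fun H => (alpha 1%N H - alpha 2%N H) / 2)].

Definition diagram_swap (i : nat) : nat :=
  if i == 1%N then 2%N else if i == 2%N then 1%N else i.

(* sigma on a, dual to alpha i |-> alpha (diagram_swap i) on the dual of a;
   the equations determine sigma H because the simple roots are a basis of the
   dual of a. *)
Definition diagram_involution a (r : nat) (alpha : nat -> 'M[F]_n -> R) H :
    'M[F]_n :=
  get [set H' | a H' /\ forall i, (1 <= i <= r)%N ->
    alpha i H' = alpha (diagram_swap i) H].

End RealLie.

Definition SO (F : numFieldType) (n : nat) : set 'M[F]_n :=
  [set A | A^T *m A = 1%:M /\ \det A = 1].

Definition cartan_theta_C (R : realType) (n : nat) (A : 'M[R[i]]_n) : 'M[R[i]]_n :=
  map_mx (@conjc R) A.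

(* SO(n) inside SO(n,C): the fixed point group of cartan_theta_C. *)
Definition SO_real (R : realType) (n : nat) : set 'M[R[i]]_n :=
  map_mx (real_complex R) @` @SO R n.

Definition signature_mx (R : realType) (p : nat) : 'M[R]_(p + p) :=
  block_mx 1%:M 0 0 (- 1%:M).

Definition SO_pp (R : realType) (p : nat) : set 'M[R]_(p + p) :=
  [set A | A^T *m signature_mx R p *m A = signature_mx R p /\ \det A = 1].

Definition SOo_pp (R : realType) (p : nat) : set 'M[R]_(p + p) :=
  connected_component (@SO_pp R p) 1%:M.

Definition cartan_theta_R (R : realType) (n : nat) (A : 'M[R]_n) : 'M[R]_n :=
  invmx A^T.

(* SO(p) x SO(p): the fixed point group of cartan_theta_R on SOo_pp. *)
Definition SO_times_SO (R : realType) (p : nat) : set 'M[R]_(p + p) :=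
  [set A | exists B C, [/\ @SO R p B, @SO R p C & A = block_mx B 0 0 C]].

(* Main.v *)
Require Import Defs.
From HB Require Import structures.
From mathcomp Require Import all_boot all_order all_algebra.
From mathcomp Require Import all_classical all_reals all_analysis.
From mathcomp Require Import ring lra.

(** Both groups are the (identity component of the) isometry group of a symmetric
    bilinear form J: J = 1 over R[i], or J = diag(1, -1) over R; and theta A is
    J (conj A) J. Elements of [a] are commuting hermitian matrices that are skew for
    J, so they have joint eigenvectors, and every restricted root is a difference
    of two weights of the defining representation. If v has weight l <> 0, then
    tau v = J (conj v) has weight - l, and the hermitian reflection w in the vector
    v + tau v preserves J, commutes with theta, and acts on [a] by
    H |-> H - 2 l(H) E_l, where E_l represents 2 l in the trace form; E_l lies in
    [a] by maximality. Conjugation by w is the required involution when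
    l = (alpha_1 - alpha_2) / 2. This is a weight by assumption for r = 4; for
    r >= 5 it follows from the Cartan integers of alpha_1, ..., alpha_5, because the
    weights are orthogonal up to sign and the simple roots are sums of two of them.
    As w permutes the simple roots, it preserves the positive roots, hence N. *)
Set Implicit Arguments.
Unset Strict Implicit.
Unset Printing Implicit Defensive.
Import Order.TTheory GRing.Theory Num.Theory.
Import numFieldNormedType.Exports.
Local Open Scope classical_set_scope.
Local Open Scope ring_scope.

(** The reflection [w] has determinant -1 and lies outside G, so stability of G under conjugation
    needs an argument; for the identity component it is continuity. Since [diagram_involution] is
    defined by choice, identifying it with conjugation by [w] takes uniqueness: an element of [a]
    killed by all simple roots is 0. This is obtained without a root space decomposition: for
    orthogonal weight vectors, v ∧ w, read as a J-skew matrix, shows that the sum of their weights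
    is a root or 0, and n > 2 provides a weight vector orthogonal to both v and tau v. For r >= 5 a
    difference of weights could a priori also be e_i or 2 e_i, as in types B and C; the equal
    lengths and the Cartan integers -1 of the diagram exclude this. Lie algebras being defined
    through [expmx], the exponential is studied along lines t X: group law, continuity, derivative
    at 0. These identify the Lie algebra of G with the J-skew matrices, and the -1 eigenspace of d
    theta with the hermitian ones among them. *)

Lemma cvg_bigsum (K : numFieldType) (V : normedModType K) (T I : Type)
    (FF : set_system T) {FFF : Filter FF} (r : seq I) (f : I -> T -> V) (l : I -> V) :
  (forall i, f i x @[x --> FF] --> l i) ->
  (\sum_(i <- r) f i x) @[x --> FF] --> \sum_(i <- r) l i.
Proof.
move=> fl; elim: r => [|i r IH].
  by under eq_fun do rewrite big_nil; rewrite big_nil; exact: cvg_cst.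
by under eq_fun do rewrite big_cons; rewrite big_cons; exact: cvgD.
Qed.

(* Abstracts the two cases F = R (trivial conjugation) and F = R[i] (complex
   conjugation), so that both families of groups are treated at once. *)
Record conj_scalars (R : realType) (F : numFieldType) (iota : {rmorphism R -> F})
  := ConjScalars {
  cj : {rmorphism F -> F};
  toC : {rmorphism F -> R[i]};
  toC_cj : forall x, toC (cj x) = conjc (toC x);
  toC_iota : forall t, toC (iota t) = real_complex R t;
  toC_norm : forall x, toC `|x| = `|toC x|;
  toC_complete : forall u : nat -> F,
    cvgn (fun k => complex.Re (toC (u k))) ->
    cvgn (fun k => complex.Im (toC (u k))) ->
    exists l, complex.Re (toC l) = limn (fun k => complex.Re (toC (u k))) /\
              complex.Im (toC l) = limn (fun k => complex.Im (toC (u k)));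
  cj_fixed : forall x, cj x = x -> exists t, x = iota t }.

(** * Real-valued norms and limits of matrices *)

Section Norms.
Context (R : realType) (F : numFieldType) (iota : {rmorphism R -> F}).
Context (D : conj_scalars iota).
Local Notation cj := (cj D).
Local Notation toC := (toC D).

Lemma toC_inj : injective toC. Proof. exact: fmorph_inj. Qed.

Lemma cjK : involutive cj.
Proof. by move=> x; apply: toC_inj; rewrite !toC_cj conjcK. Qed.

Lemma cj_iota t : cj (iota t) = iota t.
Proof. by apply: toC_inj; rewrite toC_cj !toC_iota conjc_real. Qed.

(** The norm of [F] takes its values in [F]; the estimates and squeeze arguments below take place in
    [R]. *)
Definition nr (x : F) : R := Normc.normc (toC x).

Lemma nrE x : iota (nr x) = `|x|.
Proof. by apply: toC_inj; rewrite toC_iota toC_norm. Qed.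

Lemma nr_ge0 x : 0 <= nr x.
Proof. by rewrite /nr; case: (toC x) => a b; exact: sqrtr_ge0. Qed.

Lemma nrD x y : nr (x + y) <= nr x + nr y.
Proof. by rewrite /nr rmorphD; exact: le_normcD. Qed.

Lemma nrM x y : nr (x * y) = nr x * nr y.
Proof. by rewrite /nr rmorphM Normc.normcM. Qed.

Lemma nrN x : nr (- x) = nr x.
Proof. by rewrite /nr rmorphN normcN. Qed.

Lemma nr0 : nr 0 = 0. Proof. by rewrite /nr rmorph0 Normc.normc0. Qed.
Lemma nr1 : nr 1 = 1. Proof. by rewrite /nr rmorph1 Normc.normc1. Qed.

Lemma nr_iota t : nr (iota t) = `|t|.
Proof. by rewrite /nr toC_iota /= expr0n /= addr0 sqrtr_sqr. Qed.

Lemma nr0_eq0 x : nr x = 0 -> x = 0.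
Proof.
by move=> /Normc.eq0_normc; rewrite -[RHS](rmorph0 toC) => /toC_inj.
Qed.

Lemma nr_cj x : nr (cj x) = nr x.
Proof. by rewrite /nr toC_cj; case: (toC x) => a b /=; rewrite sqrrN. Qed.

Lemma iota_ge0 t : 0 <= t -> 0 <= iota t.
Proof.
move=> t0; have -> : iota t = `|iota t| by rewrite -nrE nr_iota ger0_norm.
exact: normr_ge0.
Qed.

Lemma iota_gt0 t : 0 < t -> 0 < iota t.
Proof.
by move=> t0; rewrite lt_neqAle iota_ge0 ?(ltW t0)// eq_sym fmorph_eq0 gt_eqF.
Qed.

Lemma gt0_iota (e : F) : 0 < e -> exists2 r : R, 0 < r & e = iota r.
Proof.
move=> e0; exists (nr e); last by rewrite nrE gtr0_norm.
rewrite lt_neqAle nr_ge0 andbT; apply/eqP => /esym/nr0_eq0 e00.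
by rewrite e00 ltxx in e0.
Qed.

Lemma ltr_iota s t : (iota s < iota t) = (s < t).
Proof.
apply/idP/idP => [st|st]; last by rewrite -subr_gt0 -rmorphB iota_gt0 ?subr_gt0.
rewrite ltNge; apply/negP => ts; move: st; rewrite -subr_gt0 -rmorphB => st.
have : 0 <= iota (s - t) by rewrite iota_ge0 ?subr_ge0.
by rewrite -opprB rmorphN oppr_ge0 => /(lt_le_trans st); rewrite ltxx.
Qed.

Lemma cvg_nr (T : Type) (FF : set_system T) {FFF : Filter FF} (f : T -> F) l :
  (f x @[x --> FF] --> l) <-> (nr (f x - l) @[x --> FF] --> 0).
Proof.
split => [/cvgrPdist_lt fl|/cvgr0Pnorm_lt fl].
- apply/cvgr0Pnorm_lt => e e0; apply: filterS (fl _ (iota_gt0 e0)) => x.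
  by rewrite distrC -nrE ltr_iota ger0_norm ?nr_ge0.
- apply/cvgrPdist_lt => _ /gt0_iota[e e0 ->]; apply: filterS (fl _ e0) => x.
  by rewrite ger0_norm ?nr_ge0// distrC -nrE ltr_iota.
Qed.

(** The sum of the entries' norms is submultiplicative, which the maximum of the entries is not. The
    identity has norm n, whence the factor [n%:R] in the bounds on powers. *)
Definition mxn m n (X : 'M[F]_(m, n)) : R := \sum_i \sum_j nr (X i j).

Lemma mxn_ge0 m n (X : 'M[F]_(m, n)) : 0 <= mxn X.
Proof. by apply: sumr_ge0 => i _; apply: sumr_ge0 => j _; exact: nr_ge0. Qed.

Lemma nr_mxn m n (X : 'M[F]_(m, n)) i j : nr (X i j) <= mxn X.
Proof.
rewrite /mxn (bigD1 i)//= (bigD1 j)//= -addrA lerDl addr_ge0//.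
  by apply: sumr_ge0 => k _; exact: nr_ge0.
by apply: sumr_ge0 => k _; apply: sumr_ge0 => l _; exact: nr_ge0.
Qed.

Lemma mxn0 m n : mxn (0 : 'M[F]_(m, n)) = 0.
Proof. by rewrite /mxn big1// => i _; rewrite big1// => j _; rewrite mxE nr0. Qed.

Lemma mxnD m n (X Y : 'M[F]_(m, n)) : mxn (X + Y) <= mxn X + mxn Y.
Proof.
rewrite /mxn -big_split/=; apply: ler_sum => i _.
by rewrite -big_split/=; apply: ler_sum => j _; rewrite mxE nrD.
Qed.

Lemma mxnZ m n a (X : 'M[F]_(m, n)) : mxn (a *: X) = nr a * mxn X.
Proof.
rewrite /mxn mulr_sumr; apply: eq_bigr => i _; rewrite mulr_sumr.
by apply: eq_bigr => j _; rewrite mxE nrM.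
Qed.

Lemma mxnN m n (X : 'M[F]_(m, n)) : mxn (- X) = mxn X.
Proof. by rewrite -scaleN1r mxnZ nrN nr1 mul1r. Qed.

Lemma mxn_sum m n (I : Type) (r : seq I) (P : pred I) (f : I -> 'M[F]_(m, n)) :
  mxn (\sum_(i <- r | P i) f i) <= \sum_(i <- r | P i) mxn (f i).
Proof.
elim/big_rec2 : _ => [|i x y _ le_xy]; first by rewrite mxn0.
by apply: le_trans (mxnD _ _) _; rewrite lerD2l.
Qed.

Lemma nr_sum (I : Type) (r : seq I) (P : pred I) (f : I -> F) :
  nr (\sum_(i <- r | P i) f i) <= \sum_(i <- r | P i) nr (f i).
Proof.
elim/big_rec2 : _ => [|i x y _ le_xy]; first by rewrite nr0.
by apply: le_trans (nrD _ _) _; rewrite lerD2l.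
Qed.

Lemma mxnM m n p (X : 'M[F]_(m, n)) (Y : 'M[F]_(n, p)) :
  mxn (X *m Y) <= mxn X * mxn Y.
Proof.
rewrite /mxn mulr_suml; apply: ler_sum => i _.
apply: (@le_trans _ _ (\sum_j \sum_k nr (X i k) * nr (Y k j))).
  apply: ler_sum => j _; rewrite mxE; apply: le_trans (nr_sum _ _ _) _.
  by apply: ler_sum => k _; rewrite nrM.
rewrite exchange_big/= mulr_suml; apply: ler_sum => k _.
rewrite -mulr_sumr ler_wpM2l ?nr_ge0// (bigD1 k)//= lerDl.
by apply: sumr_ge0 => l _; apply: sumr_ge0 => q _; exact: nr_ge0.
Qed.

Lemma mxn1 n : mxn (1%:M : 'M[F]_n) = n%:R.
Proof.
have -> : n%:R = \sum_(i < n) (1 : R) by rewrite sumr_const card_ord.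
apply: eq_bigr => i _; rewrite (bigD1 i)//= big1 ?addr0 => [|j ij].
  by rewrite mxE eqxx nr1.
by rewrite mxE eq_sym (negPf ij) nr0.
Qed.

Lemma mxnX n (X : 'M[F]_n) k : mxn (X ^+ k) <= n%:R * mxn X ^+ k.
Proof.
elim: k => [|k IH]; first by rewrite !expr0 mulr1 -idmxE mxn1.
rewrite !exprS; apply: le_trans (mxnM _ _) _; rewrite mulrCA.
by rewrite ler_wpM2l ?mxn_ge0.
Qed.

Lemma cvg_mxE (T : Type) (FF : set_system T) {FFF : Filter FF} m n
    (f : T -> 'M[F]_(m, n)) (A : 'M[F]_(m, n)) :
  (f x @[x --> FF] --> A) <-> (forall i j, f x i j @[x --> FF] --> A i j).
Proof.
split => [fA i j|fA].
  exact: (cvg_comp _ _ fA (@coord_continuous F m n i j A)).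
move=> B [P PA PB]; rewrite nbhs_simpl/=.
apply: filterS (_ : \forall x \near FF, forall i j, P i j (f x i j)).
  by move=> x Px; exact: PB.
by apply: filter_forall => i; apply: filter_forall => j; exact: fA (PA i j).
Qed.

Lemma cvg_mxn (T : Type) (FF : set_system T) {FFF : Filter FF} m n
    (f : T -> 'M[F]_(m, n)) (A : 'M[F]_(m, n)) :
  (f x @[x --> FF] --> A) <-> (mxn (f x - A) @[x --> FF] --> 0).
Proof.
split => [/cvg_mxE fA|fA].
- rewrite -[X in _ --> X](_ : \sum_(i < m) \sum_(j < n) (0 : R) = 0); last first.
    by rewrite big1// => i _; rewrite big1.
  apply: cvg_bigsum => i; apply: cvg_bigsum => j.
  by under eq_fun do rewrite !mxE; exact/cvg_nr.
- apply/cvg_mxE => i j; apply/cvg_nr.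
  apply: (@squeeze_cvgr _ _ _ _ (fun=> 0) (fun x => mxn (f x - A))) => //.
    apply: nearW => x; rewrite nr_ge0/=.
    by have := nr_mxn (f x - A) i j; rewrite !mxE.
  exact: cvg_cst.
Qed.

Lemma cvg_mxn_squeeze (T : Type) (FF : set_system T) {FFF : Filter FF} m n
    (f : T -> 'M[F]_(m, n)) (A : 'M[F]_(m, n)) (g : T -> R) :
  (\forall x \near FF, mxn (f x - A) <= g x) -> g x @[x --> FF] --> 0 ->
  f x @[x --> FF] --> A.
Proof.
move=> fg g0; apply/cvg_mxn.
apply: (@squeeze_cvgr _ _ _ _ (fun=> 0) g) => //; last exact: cvg_cst.
by apply: filterS fg => x ->; rewrite mxn_ge0.
Qed.

Lemma cvg_mx_unique (T : Type) (FF : set_system T) {FFF : ProperFilter FF} m n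
    (f : T -> 'M[F]_(m, n)) (A B : 'M[F]_(m, n)) :
  f x @[x --> FF] --> A -> f x @[x --> FF] --> B -> A = B.
Proof.
move=> /cvg_mxE fA /cvg_mxE fB; apply/matrixP => i j.
exact: (cvg_unique _ (fA i j) (fB i j)).
Qed.

Lemma cvg_mx_lim (T : Type) (FF : set_system T) {FFF : ProperFilter FF} n
    (f : T -> 'M[F]_n) (A : 'M[F]_n) :
  f x @[x --> FF] --> A -> lim (f x @[x --> FF]) = A.
Proof. by move=> fA; apply: cvg_mx_unique (fA); exact: cvgP fA. Qed.

Lemma cvg_mxn_le (T : Type) (FF : set_system T) {FFF : ProperFilter FF} m n
    (f : T -> 'M[F]_(m, n)) (A : 'M[F]_(m, n)) (b : R) :
  f x @[x --> FF] --> A -> (\forall x \near FF, mxn (f x) <= b) -> mxn A <= b.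
Proof.
move=> /cvg_mxn/cvgr0Pnorm_lt fA fb; apply/ler_addgt0Pr => e e0.
have [x []] := filter_ex (filterI fb (fA _ e0)) => fxb.
rewrite ger0_norm ?mxn_ge0// => fxA.
rewrite -(subrK (f x) A); apply: le_trans (mxnD _ _) _.
by rewrite addrC lerD// -mxnN opprB ltW.
Qed.

Lemma cvg_mulmx (T : Type) (FF : set_system T) {FFF : Filter FF} m n p
    (f : T -> 'M[F]_(m, n)) (g : T -> 'M[F]_(n, p))
    (A : 'M[F]_(m, n)) (B : 'M[F]_(n, p)) :
  f x @[x --> FF] --> A -> g x @[x --> FF] --> B ->
  (f x *m g x) @[x --> FF] --> A *m B.
Proof.
move=> /cvg_mxE fA /cvg_mxE gB; apply/cvg_mxE => i j.
rewrite mxE -[X in X @ _](_ : (fun x => \sum_k f x i k * g x k j) = _); last first.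
  by apply/funext => x; rewrite mxE.
by apply: cvg_bigsum => k; exact: cvgM.
Qed.

Lemma cvg_trmx (T : Type) (FF : set_system T) {FFF : Filter FF} m n
    (f : T -> 'M[F]_(m, n)) (A : 'M[F]_(m, n)) :
  f x @[x --> FF] --> A -> (f x)^T @[x --> FF] --> A^T.
Proof.
move=> /cvg_mxE fA; apply/cvg_mxE => i j.
by rewrite mxE; under eq_fun do rewrite mxE; exact: fA.
Qed.

Lemma cvg_conjmx (T : Type) (FF : set_system T) {FFF : Filter FF} m n
    (f : T -> 'M[F]_(m, n)) (A : 'M[F]_(m, n)) :
  f x @[x --> FF] --> A -> map_mx cj (f x) @[x --> FF] --> map_mx cj A.
Proof.
move=> /cvg_mxE fA; apply/cvg_mxE => i j; apply/cvg_nr.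
rewrite mxE; under eq_fun do rewrite mxE -rmorphB nr_cj.
exact/cvg_nr.
Qed.

Lemma cvg_mxD (T : Type) (FF : set_system T) {FFF : Filter FF} m n
    (f g : T -> 'M[F]_(m, n)) (A B : 'M[F]_(m, n)) :
  f x @[x --> FF] --> A -> g x @[x --> FF] --> B ->
  (f x + g x) @[x --> FF] --> A + B.
Proof.
move=> /cvg_mxE fA /cvg_mxE gB; apply/cvg_mxE => i j.
by rewrite mxE; under eq_fun do rewrite mxE; exact: cvgD.
Qed.

End Norms.

(** * The matrix exponential *)

Section DoubleSums.
Context (V : zmodType).

Lemma sum_triangle (f : nat -> nat -> V) m :
  \sum_(0 <= k < m) \sum_(0 <= l < m - k) f k l =
  \sum_(0 <= d < m) \sum_(0 <= k < d.+1) f k (d - k)%N.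
Proof.
elim: m => [|m IH]; first by rewrite !big_nil.
rewrite [RHS]big_nat_recr//= -IH big_nat_recr//= subSnn big_nat1.
rewrite [X in _ = _ + X]big_nat_recr//= subnn addrA; congr (_ + _).
rewrite -big_split/=; apply: eq_big_nat => k /andP[_ km].
by rewrite subSn ?(ltnW km)// big_nat_recr.
Qed.

(** The antidiagonals below m form a partial sum of the Cauchy product; what remains of the square,
    the terms with k + l >= m, is its error. *)
Lemma sum_square_triangle (f : nat -> nat -> V) m :
  \sum_(0 <= k < m) \sum_(0 <= l < m) f k l =
  \sum_(0 <= d < m) \sum_(0 <= k < d.+1) f k (d - k)%N +
  \sum_(0 <= k < m) \sum_(m - k <= l < m) f k l.
Proof.
rewrite -sum_triangle -big_split/=; apply: eq_big_nat => k _.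
by rewrite -(@big_cat_nat _ _ _ (m - k)%N) ?leq_subr.
Qed.
End DoubleSums.

Lemma exp_coeffD (K : numFieldType) (s t : K) d :
  \sum_(0 <= k < d.+1) (s ^+ k / k`!%:R) * (t ^+ (d - k) / (d - k)`!%:R) =
  (s + t) ^+ d / d`!%:R.
Proof.
rewrite addrC exprDn mulr_suml big_mkord; apply: eq_bigr => -[k /=] kd _.
rewrite ltnS in kd; rewrite -mulr_natr.
have fn0 i : (i`!%:R : K) != 0 by rewrite pnatr_eq0 -lt0n fact_gt0.
have -> : (d`!%:R : K) = 'C(d, k)%:R * (k`!%:R * (d - k)`!%:R).
  by rewrite -!natrM bin_fact.
have C0 : ('C(d, k)%:R : K) != 0 by rewrite pnatr_eq0 -lt0n bin_gt0.
by field; rewrite !fn0 C0.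
Qed.

Lemma normc_le_ReIm (R : rcfType) (z : R[i]) :
  Normc.normc z <= `|complex.Re z| + `|complex.Im z|.
Proof.
case: z => a b /=; rewrite -(@ler_pXn2r _ 2) ?nnegrE ?sqrtr_ge0 ?addr_ge0//.
rewrite sqr_sqrtr ?addr_ge0 ?sqr_ge0// sqrrD !real_normK ?num_real//.
by rewrite lerD2r lerDl mulrn_wge0 ?mulr_ge0.
Qed.

Lemma normRe_le_normc (R : rcfType) (z : R[i]) : `|complex.Re z| <= Normc.normc z.
Proof. by case: z => a b /=; rewrite -sqrtr_sqr ler_wsqrtr// lerDl sqr_ge0. Qed.

Lemma normIm_le_normc (R : rcfType) (z : R[i]) : `|complex.Im z| <= Normc.normc z.
Proof. by case: z => a b /=; rewrite -sqrtr_sqr ler_wsqrtr// lerDr sqr_ge0. Qed.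

Section MatrixExponential.
Context (R : realType) (F : numFieldType) (iota : {rmorphism R -> F}).
Context (D : conj_scalars iota) (n : nat).
Implicit Types (X Y : 'M[F]_n).

Definition exp_sum X m : 'M[F]_n := \sum_(0 <= k < m) (k`!%:R : F)^-1 *: X ^+ k.

Lemma nr_natV k : nr D (k%:R^-1) = k%:R^-1.
Proof.
have -> : (k%:R^-1 : F) = iota (k%:R^-1) by rewrite fmorphV rmorph_nat.
by rewrite nr_iota ger0_norm// invr_ge0 ler0n.
Qed.

Lemma mxn_exp_term X k (c : R) : mxn D X <= c ->
  mxn D ((k`!%:R : F)^-1 *: X ^+ k) <= n%:R * exp_coeff c k.
Proof.
move=> Xc; rewrite mxnZ nr_natV /exp_coeff/= [_ / _]mulrC mulrCA.
rewrite ler_wpM2l ?invr_ge0 ?ler0n//; apply: le_trans (mxnX _ _ _) _.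
by rewrite ler_wpM2l ?ler0n// lerXn2r ?nnegrE ?mxn_ge0// (le_trans _ Xc)// mxn_ge0.
Qed.

(** The real and imaginary parts of each entry are series dominated by n times the exponential
    series of [mxn D X]; [toC_complete] assembles their limits into an element of [F]. *)
Lemma cvg_exp_sum X : exists L : 'M[F]_n, exp_sum X m @[m --> \oo] --> L.
Proof.
have tle i j k : nr D (((k`!%:R : F)^-1 *: X ^+ k) i j) <=
    n%:R * exp_coeff (mxn D X) k.
  exact: le_trans (nr_mxn _ _ _ _) (mxn_exp_term _ (lexx _)).
have bnd : cvgn (series (fun k => n%:R * exp_coeff (mxn D X) k)).
  exact: is_cvg_seriesZ (is_cvg_series_exp_coeff _).
have cvgs (g : nat -> R) i j :
    (forall k, `|g k| <= nr D (((k`!%:R : F)^-1 *: X ^+ k) i j)) -> cvgn (series g).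
  move=> gle; apply: normed_cvg.
  apply: series_le_cvg bnd => [k|k|k]; first exact: normr_ge0.
    by rewrite mulr_ge0 ?ler0n// exp_coeff_ge0 ?mxn_ge0.
  exact: le_trans (gle k) (tle _ _ _).
have ex i j : exists l : F, (exp_sum X m) i j @[m --> \oo] --> l.
  pose v k := toC D (((k`!%:R : F)^-1 *: X ^+ k) i j).
  have uE m : toC D (exp_sum X m i j) = \sum_(0 <= k < m) v k.
    by rewrite /exp_sum summxE rmorph_sum.
  have ReE : (fun m => complex.Re (toC D (exp_sum X m i j))) =
      series (fun k => complex.Re (v k)).
    apply/funext => m; rewrite uE; apply: (big_morph (@complex.Re R)) => //.
    by move=> [a b] [c d].
  have ImE : (fun m => complex.Im (toC D (exp_sum X m i j))) =
      series (fun k => complex.Im (v k)).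
    apply/funext => m; rewrite uE; apply: (big_morph (@complex.Im R)) => //.
    by move=> [a b] [c d].
  have cRe : cvgn (fun m => complex.Re (toC D (exp_sum X m i j))).
    by rewrite ReE; apply: (cvgs _ i j) => k; exact: normRe_le_normc.
  have cIm : cvgn (fun m => complex.Im (toC D (exp_sum X m i j))).
    by rewrite ImE; apply: (cvgs _ i j) => k; exact: normIm_le_normc.
  have [l [lRe lIm]] := toC_complete cRe cIm.
  exists l; apply/(cvg_nr D).
  apply: (@squeeze_cvgr _ _ _ _ (fun=> 0) (fun m =>
    `|complex.Re (toC D (exp_sum X m i j)) - complex.Re (toC D l)| +
    `|complex.Im (toC D (exp_sum X m i j)) - complex.Im (toC D l)|)).
  - apply: nearW => m; rewrite nr_ge0/= /nr rmorphB.
    apply: le_trans (normc_le_ReIm _) _.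
    by move: (toC D (exp_sum X m i j)) (toC D l) => [p q] [p' q'] /=.
  - exact: cvg_cst.
  - rewrite -[X in _ --> X](addr0 (0 : R)); apply: cvgD.
    + by rewrite lRe -(@normr0 R R); apply: cvg_norm; exact/subr_cvg0.
    + by rewrite lIm -(@normr0 R R); apply: cvg_norm; exact/subr_cvg0.
pose L := \matrix_(i, j) projT1 (cid (ex i j)).
exists L; apply/cvg_mxE => i j; rewrite mxE.
by case: (cid _).
Qed.

Lemma cvg_expmx X : exp_sum X m @[m --> \oo] --> expmx X.
Proof.
have [L XL] := cvg_exp_sum X.
by rewrite [expmx X](_ : _ = L)//; exact: cvg_mx_lim XL.
Qed.

Lemma expmx_unique X (L : 'M[F]_n) : exp_sum X m @[m --> \oo] --> L -> expmx X = L.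
Proof. by move=> XL; exact: (cvg_mx_unique (@cvg_expmx X) XL). Qed.

Lemma exprZmx (a : F) X k : (a *: X) ^+ k = a ^+ k *: X ^+ k.
Proof.
elim: k => [|k IH]; first by rewrite !expr0 scale1r.
by rewrite !exprS IH -[LHS]scalemxAl -scalemxAr scalerA.
Qed.

(* The error of the Cauchy product is dominated by the same error for the scalar
   exponential series, which tends to 0 because of [expRD]. *)
Lemma exp_sumM X (s t : R) m (c : R) :
    `|s| * mxn D X <= c -> `|t| * mxn D X <= c ->
  mxn D (exp_sum (iota s *: X) m *m exp_sum (iota t *: X) m -
       exp_sum (iota (s + t) *: X) m) <=
  n%:R * (series (exp_coeff c) m * series (exp_coeff c) m -
          series (exp_coeff (c + c)) m).
Proof.
move=> sc tc; have c0 : 0 <= c by apply: le_trans sc; rewrite mulr_ge0 ?mxn_ge0.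
pose f k l := ((iota s ^+ k / k`!%:R) * (iota t ^+ l / l`!%:R)) *: X ^+ (k + l).
have -> : exp_sum (iota s *: X) m *m exp_sum (iota t *: X) m =
    \sum_(0 <= k < m) \sum_(0 <= l < m) f k l.
  rewrite /exp_sum mulmx_suml; apply: eq_bigr => k _.
  rewrite mulmx_sumr; apply: eq_bigr => l _.
  rewrite !exprZmx !scalerA -scalemxAl -scalemxAr scalerA /f exprD.
  by rewrite ![_ / _]mulrC.
have -> : exp_sum (iota (s + t) *: X) m =
    \sum_(0 <= d < m) \sum_(0 <= k < d.+1) f k (d - k)%N.
  apply: eq_bigr => d _; rewrite exprZmx scalerA mulrC rmorphD -exp_coeffD.
  rewrite scaler_suml; apply: eq_big_nat => k /andP[_ kd].
  by rewrite /f subnKC.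
rewrite sum_square_triangle addrAC subrr add0r.
have -> : series (exp_coeff c) m * series (exp_coeff c) m -
    series (exp_coeff (c + c)) m =
    \sum_(0 <= k < m) \sum_(m - k <= l < m) exp_coeff c k * exp_coeff c l.
  rewrite /series/= big_distrlr/=.
  rewrite sum_square_triangle addrC addrA [X in X + _ = _](_ : _ = 0) ?add0r//.
  rewrite addrC; apply/eqP; rewrite subr_eq0; apply/eqP; apply: eq_bigr => d _.
  by rewrite [RHS]/exp_coeff/= -exp_coeffD.
rewrite mulr_sumr; apply: le_trans (mxn_sum _ _ _ _) _.
apply: ler_sum => k _; rewrite mulr_sumr; apply: le_trans (mxn_sum _ _ _ _) _.
apply: ler_sum => l _; rewrite /f mxnZ; apply: le_trans.
  by apply: ler_wpM2l (mxnX _ _ _); exact: nr_ge0.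
rewrite mulrCA ler_wpM2l ?ler0n//.
have nrc (r : R) i : `|r| * mxn D X <= c ->
    nr D (iota r ^+ i / i`!%:R) * mxn D X ^+ i <= exp_coeff c i.
  move=> rc; rewrite nrM nr_natV -rmorphXn nr_iota normrX /exp_coeff/=.
  rewrite mulrAC -exprMn ler_wpM2r ?invr_ge0 ?ler0n//.
  by rewrite lerXn2r ?nnegrE// mulr_ge0 ?mxn_ge0.
rewrite exprD nrM mulrACA ler_pM ?mulr_ge0 ?nr_ge0 ?exprn_ge0 ?mxn_ge0//.
- exact: nrc.
- exact: nrc.
Qed.

Lemma expmxDZ X (s t : R) :
  expmx (iota (s + t) *: X) = expmx (iota s *: X) *m expmx (iota t *: X).
Proof.
pose c := (`|s| + `|t|) * mxn D X.
(* The error bound of [exp_sumM] tends to exp(c) exp(c) - exp(c + c) = 0. *)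
have cD : series (exp_coeff c) m * series (exp_coeff c) m -
    series (exp_coeff (c + c)) m @[m --> \oo] --> 0.
  rewrite -[X in _ --> X](subrr (expR (c + c))) {1}expRD.
  have h d := is_cvg_series_exp_coeff (d : R).
  by apply: cvgB; [apply: cvgM|]; exact: h.
have h0 : (exp_sum (iota (s + t) *: X) m -
    exp_sum (iota s *: X) m *m exp_sum (iota t *: X) m) @[m --> \oo] --> (0 : 'M[F]_n).
  apply: (@cvg_mxn_squeeze _ _ _ D _ _ _ _ _ _ _ (fun m =>
    n%:R * (series (exp_coeff c) m * series (exp_coeff c) m -
            series (exp_coeff (c + c)) m))).
    apply: nearW => m; rewrite subr0 -mxnN opprB.
    by apply: exp_sumM; rewrite ler_wpM2r ?mxn_ge0// ?lerDl ?lerDr.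
  by rewrite -(mulr0 (n%:R)); apply: cvgM => //; exact: cvg_cst.
have h1 : (exp_sum (iota s *: X) m *m exp_sum (iota t *: X) m +
    (exp_sum (iota (s + t) *: X) m -
      exp_sum (iota s *: X) m *m exp_sum (iota t *: X) m)) @[m --> \oo] -->
    expmx (iota s *: X) *m expmx (iota t *: X) + 0.
  apply: cvg_mxD => //; apply: cvg_mulmx; exact: cvg_expmx.
rewrite addr0 in h1; apply: expmx_unique; apply: cvg_trans h1.
by apply: near_eq_cvg; apply: nearW => m; rewrite addrC subrK.
Qed.

Lemma expmx0 : expmx (0 : 'M[F]_n) = 1%:M.
Proof.
apply: expmx_unique; apply: cvg_near_cst; near=> m.
have m0 : (0 < m)%N by near: m; exact: nbhs_infty_gt.
rewrite /exp_sum big_ltn// big_nat big1 => [|k /andP[k0 _]].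
  by rewrite addr0 fact0 invr1 scale1r.
by rewrite expr0n gtn_eqF// scaler0.
Unshelve. all: by end_near. Qed.

(** In the terms with k >= 2, |t|^k <= t^2 as |t| <= 1, and what is left is part of the exponential
    series of [mxn D X]. This quadratic bound yields both the derivative at 0 and continuity. *)
Lemma expmx_sub1_bound X (t : R) : `|t| <= 1 ->
  mxn D (expmx (iota t *: X) - 1%:M - iota t *: X) <=
  t ^+ 2 * (n%:R * expR (mxn D X)).
Proof.
move=> t1.
have h : (exp_sum (iota t *: X) m - (1%:M + iota t *: X)) @[m --> \oo] -->
    expmx (iota t *: X) - (1%:M + iota t *: X).
  by apply: cvg_mxD; [exact: cvg_expmx | exact: cvg_cst].
rewrite -addrA -opprD; apply: (cvg_mxn_le h); near=> m.
have m2 : (2 <= m)%N by near: m; exact: nbhs_infty_ge.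
rewrite /exp_sum (@big_cat_nat _ _ _ 2)//= big_nat_recl// big_nat1.
rewrite !invr1 !scale1r expr0 expr1 -idmxE [_ + _ - _]addrAC subrr add0r.
apply: le_trans (mxn_sum _ _ _ _) _.
apply: (@le_trans _ _ (t ^+ 2 * (n%:R *
   \sum_(2 <= k < m) exp_coeff (mxn D X) k))).
  rewrite !mulr_sumr; apply: ler_sum_nat => k /andP[k2 _].
  rewrite exprZmx scalerA mulrC -scalerA mxnZ -rmorphXn nr_iota.
  rewrite ler_pM ?mxn_ge0//; last exact: mxn_exp_term.
  rewrite -(subnKC k2) exprD normrM normrX real_normK ?num_real//.
  by rewrite ler_piMr ?sqr_ge0// normrX exprn_ile1.
rewrite ler_wpM2l ?sqr_ge0// ler_wpM2l ?ler0n//.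
apply: le_trans (_ : series (exp_coeff (mxn D X)) m <= _).
  rewrite /series/= (@big_cat_nat _ _ _ 2 0 m)//= lerDr.
  by rewrite sumr_ge0// => k _; rewrite exp_coeff_ge0 ?mxn_ge0.
apply: nondecreasing_cvgn_le; last exact: is_cvg_series_exp_coeff.
by apply: nondecreasing_series => k _ _; rewrite exp_coeff_ge0 ?mxn_ge0.
Unshelve. all: by end_near. Qed.

Lemma expmx_derivative0 X :
  ((iota t)^-1 *: (expmx (iota t *: X) - 1%:M)) @[t --> (0 : R)^'] --> X.
Proof.
pose b := n%:R * expR (mxn D X).
apply: (@cvg_mxn_squeeze _ _ _ D _ _ _ _ _ _ _ (fun t => `|t| * b)).
  near=> t; have t0 : t != 0 by near: t; exact: nbhs_dnbhs_neq.
  have t1 : `|t| <= 1.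
    near: t; apply: dnbhs0_le; exact: ltr01.
  have it0 : iota t != 0 by rewrite fmorph_eq0.
  have -> : (iota t)^-1 *: (expmx (iota t *: X) - 1%:M) - X =
      (iota t)^-1 *: (expmx (iota t *: X) - 1%:M - iota t *: X).
    by rewrite [in RHS]scalerBr scalerA mulVf// scale1r.
  rewrite mxnZ -fmorphV nr_iota normfV ler_pdivrMl ?normr_gt0//.
  by rewrite mulrA -expr2 real_normK ?num_real// expmx_sub1_bound.
rewrite -[X in _ --> X](mul0r b); apply: cvgM; last exact: cvg_cst.
rewrite -[X in _ --> X](@normr0 R R); apply: cvg_norm.
by apply: cvg_within_filter; exact: cvg_id.
Unshelve. all: by end_near. Qed.

Lemma continuous_expmx X : continuous (fun t : R => expmx (iota t *: X)).
Proof.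
(* The group law turns continuity at t into the estimate of exp((s - t) X) - 1: its linear term and
   quadratic remainder are together at most |s - t| b. *)
move=> t; pose b := mxn D X + n%:R * expR (mxn D X).
apply: (@cvg_mxn_squeeze _ _ _ D _ _ _ _ _ _ _
  (fun s => mxn D (expmx (iota t *: X)) * (`|t - s| * b))).
  near=> s; have st1 : `|s - t| <= 1.
    rewrite distrC; near: s; apply: cvgr_dist_le => //; exact: cvg_id.
  have -> : expmx (iota s *: X) - expmx (iota t *: X) =
      expmx (iota t *: X) *m (expmx (iota (s - t) *: X) - 1%:M).
    by rewrite mulmxBr mulmx1 -expmxDZ [t + _]addrC subrK.
  apply: le_trans (mxnM _ _ _) _; rewrite ler_wpM2l ?mxn_ge0// distrC.
  have -> : expmx (iota (s - t) *: X) - 1%:M =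
      (expmx (iota (s - t) *: X) - 1%:M - iota (s - t) *: X) +
      iota (s - t) *: X by rewrite subrK.
  apply: le_trans (mxnD _ _ _) _; rewrite addrC mulrDr mxnZ nr_iota lerD2l.
  apply: le_trans (expmx_sub1_bound X st1) _.
  rewrite -real_normK ?num_real// ler_wpM2r ?mulr_ge0 ?ler0n ?expR_ge0//.
  by rewrite expr2 ler_piMr.
have ts0 : (t - s) @[s --> t] --> (0 : R).
  by rewrite -[X in _ --> X](subrr t); apply: cvgB; [exact: cvg_cst|exact: cvg_id].
have nts0 : `|t - s| @[s --> t] --> (0 : R).
  by rewrite -[X in _ --> X](@normr0 R R); exact: cvg_norm ts0.
have h : mxn D (expmx (iota t *: X)) * (`|t - s| * b) @[s --> t] -->
    mxn D (expmx (iota t *: X)) * (0 * b).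
  by apply: cvgM; [exact: cvg_cst | apply: cvgM => //; exact: cvg_cst].
by rewrite mul0r mulr0 in h.
Unshelve. all: by end_near. Qed.

End MatrixExponential.

Arguments cvg_expmx {R F iota} D {n} X.
Arguments expmx_derivative0 {R F iota} D {n} X.
Arguments continuous_expmx {R F iota} D {n} X.

(** * Conjugate and adjoint matrices *)

Section Adjoint.
Context (R : realType) (F : numFieldType) (iota : {rmorphism R -> F}).
Context (D : conj_scalars iota).
Local Notation cj := (cj D).

Definition conjmx m n (X : 'M[F]_(m, n)) : 'M[F]_(m, n) := map_mx cj X.
Definition adjmx m n (X : 'M[F]_(m, n)) : 'M[F]_(n, m) := (conjmx X)^T.

Lemma conjmxK m n : involutive (@conjmx m n).
Proof. by move=> X; apply/matrixP => i j; rewrite !mxE cjK. Qed.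

Lemma conjmxM m n p (X : 'M[F]_(m, n)) (Y : 'M[F]_(n, p)) :
  conjmx (X *m Y) = conjmx X *m conjmx Y.
Proof. exact: map_mxM. Qed.

Lemma conjmxD m n (X Y : 'M[F]_(m, n)) : conjmx (X + Y) = conjmx X + conjmx Y.
Proof. exact: map_mxD. Qed.

Lemma conjmxN m n (X : 'M[F]_(m, n)) : conjmx (- X) = - conjmx X.
Proof. exact: map_mxN. Qed.

Lemma conjmxZ m n a (X : 'M[F]_(m, n)) : conjmx (a *: X) = cj a *: conjmx X.
Proof. exact: map_mxZ. Qed.

Lemma conjmx1 n : conjmx (1%:M : 'M[F]_n) = 1%:M.
Proof. by rewrite /conjmx map_mx1. Qed.

Lemma conj_trmx m n (X : 'M[F]_(m, n)) : conjmx X^T = (conjmx X)^T.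
Proof. by rewrite /conjmx map_trmx. Qed.

Lemma conjmx0 m n : conjmx (0 : 'M[F]_(m, n)) = 0.
Proof. exact: map_mx0. Qed.

Lemma adjmxE m n (X : 'M[F]_(m, n)) : adjmx X = (conjmx X)^T.
Proof. by []. Qed.

Lemma adjmx0 m n : adjmx (0 : 'M[F]_(m, n)) = 0.
Proof. by rewrite /adjmx conjmx0 trmx0. Qed.

Lemma adjmx1 n : adjmx (1%:M : 'M[F]_n) = 1%:M.
Proof. by rewrite /adjmx conjmx1 trmx1. Qed.

Lemma mxtrace_adj n (X : 'M[F]_n) : \tr (adjmx X) = cj (\tr X).
Proof. by rewrite mxtrace_tr /conjmx trace_map_mx. Qed.

Lemma adjmxK m n (X : 'M[F]_(m, n)) : adjmx (adjmx X) = X.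
Proof. by rewrite /adjmx conj_trmx conjmxK trmxK. Qed.

Lemma adjmxM m n p (X : 'M[F]_(m, n)) (Y : 'M[F]_(n, p)) :
  adjmx (X *m Y) = adjmx Y *m adjmx X.
Proof. by rewrite /adjmx conjmxM trmx_mul. Qed.

Lemma adjmxD m n (X Y : 'M[F]_(m, n)) : adjmx (X + Y) = adjmx X + adjmx Y.
Proof. by rewrite /adjmx conjmxD linearD. Qed.

Lemma adjmxN m n (X : 'M[F]_(m, n)) : adjmx (- X) = - adjmx X.
Proof. by rewrite /adjmx conjmxN linearN. Qed.

Lemma adjmxZ m n a (X : 'M[F]_(m, n)) : adjmx (a *: X) = cj a *: adjmx X.
Proof. by rewrite /adjmx conjmxZ linearZ. Qed.

Lemma trmx_adj m n (X : 'M[F]_(m, n)) : X^T = conjmx (adjmx X).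
Proof. by rewrite /adjmx conj_trmx conjmxK. Qed.

Lemma adjmx_eq0 m n (X : 'M[F]_(m, n)) : (adjmx X == 0) = (X == 0).
Proof.
apply/eqP/eqP => [X0|->]; last exact: adjmx0.
by rewrite -[X]adjmxK X0 adjmx0.
Qed.

Lemma mul_adjmx_eq0 m n (X : 'M[F]_(m, n)) : \tr (adjmx X *m X) = 0 -> X = 0.
Proof.
move=> trX; apply/matrixP => i j; rewrite mxE.
have term (x : F) : toC D (cj x * x) = real_complex R (nr D x ^+ 2).
  rewrite rmorphM toC_cj mulrC -sqr_normc -toC_norm -(nrE D) toC_iota.
  by rewrite -rmorphXn.
have : \sum_(k < n) \sum_(l < m) nr D (X l k) ^+ 2 = 0.
  apply: (@complexI R); rewrite rmorph0 -[RHS](rmorph0 (toC D)) -trX.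
  rewrite /mxtrace !rmorph_sum; apply: eq_bigr => k _.
  rewrite mxE !rmorph_sum; apply: eq_bigr => l _.
  by rewrite !mxE term.
move/eqP; rewrite psumr_eq0 => [/allP/(_ j)|k _]; last first.
  by apply: sumr_ge0 => l _; exact: sqr_ge0.
rewrite mem_index_enum => /(_ isT)/=.
rewrite psumr_eq0 => [/allP/(_ i)|l _]; last exact: sqr_ge0.
by rewrite mem_index_enum => /(_ isT)/=; rewrite sqrf_eq0 => /eqP/nr0_eq0.
Qed.

Lemma adj_self_eq0 n (v : 'cV[F]_n) : adjmx v *m v = 0 -> v = 0.
Proof. by move=> v0; apply: mul_adjmx_eq0; rewrite v0 linear0. Qed.

End Adjoint.

(** * The Lie algebra of an orthogonal group and its hermitian part *)

Section OrthogonalLie.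
Context (R : realType) (F : numFieldType) (iota : {rmorphism R -> F}).
Context (D : conj_scalars iota) (n : nat).
Implicit Types (X Y w : 'M[F]_n).
Local Notation conjmx := (conjmx D).
Local Notation adjmx := (adjmx D).

Lemma expmx_conj w w' X : w' *m w = 1%:M ->
  expmx (w *m X *m w') = w *m expmx X *m w'.
Proof.
move=> w'w; apply: (expmx_unique D).
have powE k : (w *m X *m w') ^+ k = w *m X ^+ k *m w'.
  elim: k => [|k IH]; first by rewrite !expr0 -idmxE mulmx1 (mulmx1C w'w).
  by rewrite !exprS IH -!mulmxE !mulmxA -(mulmxA _ w' w) w'w mulmx1.
have sumE m : exp_sum (w *m X *m w') m = w *m exp_sum X m *m w'.
  rewrite /exp_sum mulmx_sumr mulmx_suml; apply: eq_bigr => k _.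
  by rewrite powE -scalemxAr -scalemxAl.
under eq_fun do rewrite sumE.
apply: cvg_mulmx; last exact: cvg_cst.
by apply: cvg_mulmx; [exact: cvg_cst | exact: (cvg_expmx D)].
Qed.

Lemma expmx_tr X : expmx X^T = (expmx X)^T.
Proof.
apply: (expmx_unique D).
have sumE m : exp_sum X^T m = (exp_sum X m)^T.
  rewrite /exp_sum linear_sum; apply: eq_bigr => k _; rewrite linearZ/=.
  congr (_ *: _); elim: k => [|k IH]; first by rewrite !expr0 -idmxE trmx1.
  by rewrite exprS exprSr IH trmx_mul.
by under eq_fun do rewrite sumE; apply: cvg_trmx; exact: (cvg_expmx D).
Qed.

Lemma expmxNK X t : expmx (iota (- t) *: X) *m expmx (iota t *: X) = 1%:M.
Proof. by rewrite -(expmxDZ D) addNr rmorph0 scale0r (expmx0 D). Qed.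

Lemma differential_mulmx w w' X : w *m w' = 1%:M ->
  differential_at1 iota (fun A => w *m A *m w') X (w *m X *m w').
Proof.
move=> ww'; rewrite /differential_at1.
have E t : (iota t)^-1 *: (w *m expmx (iota t *: X) *m w' - 1%:M) =
    w *m ((iota t)^-1 *: (expmx (iota t *: X) - 1%:M)) *m w'.
  by rewrite -scalemxAr -scalemxAl mulmxBr mulmxBl mulmx1 ww'.
under eq_fun do rewrite E.
apply: cvg_mulmx; last exact: cvg_cst.
by apply: cvg_mulmx; [exact: cvg_cst | exact: (expmx_derivative0 D)].
Qed.

Context (J : 'M[F]_n).
Hypothesis JJ : J *m J = 1%:M.

(** Hermitian means [w^T = conjmx w], and the last hypothesis makes this J w J; hence w^T J w = J w
    w = J. *)
Lemma form_preserved w : w *m w = 1%:M -> adjmx w = w -> J *m conjmx w *m J = w ->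
  w^T *m J *m w = J.
Proof.
move=> ww wh wJ; have cw : conjmx w = J *m w *m J.
  by rewrite -{2}wJ !mulmxA JJ mul1mx -mulmxA JJ mulmx1.
by rewrite (trmx_adj D) wh cw -(mulmxA _ J J) JJ mulmx1 -mulmxA ww mulmx1.
Qed.

Definition skew_J X := X^T *m J + J *m X = 0.

Lemma skew_JE X : skew_J X <-> X^T = - (J *m X *m J).
Proof.
split => [/(congr1 (mulmx^~ J))|E].
  by rewrite mulmxDl mul0mx -mulmxA JJ mulmx1 => /eqP; rewrite addr_eq0 => /eqP.
by rewrite /skew_J E mulNmx -!mulmxA JJ mulmx1 addNr.
Qed.

Lemma skew_J_conj w X : w *m w = 1%:M -> w^T *m J *m w = J -> skew_J X ->
  skew_J (w *m X *m w).
Proof.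
move=> ww wJ XJ; rewrite /skew_J.
have wJ' : w^T *m J = J *m w.
  by rewrite -[RHS](congr1 (mulmx^~ w) wJ) -!mulmxA ww mulmx1.
have -> : (w *m X *m w)^T *m J + J *m (w *m X *m w) =
    w^T *m (X^T *m J + J *m X) *m w.
  rewrite !trmx_mul mulmxDr mulmxDl -!mulmxA wJ' !mulmxA wJ'.
  by rewrite -!mulmxA.
by rewrite XJ mulmx0 mul0mx.
Qed.

Lemma expmx_skew X t : skew_J X ->
  (expmx (iota t *: X))^T *m J *m expmx (iota t *: X) = J.
Proof.
move=> /skew_JE XJ; rewrite -expmx_tr linearZ/= XJ.
have -> : iota t *: - (J *m X *m J) = J *m (iota (- t) *: X) *m J.
  by rewrite rmorphN scaleNr scalerN mulmxN mulNmx -scalemxAr -scalemxAl.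
rewrite expmx_conj// -!mulmxA (mulmxA J J) JJ mul1mx.
by rewrite expmxNK mulmx1.
Qed.

Lemma det_expmx_skew X t : skew_J X -> \det (expmx (iota t *: X)) = 1.
Proof.
(* Preserving [J] only gives determinant 1 or -1; the exponential is a square, which settles the
   sign. *)
move=> XJ; have -> : t = t / 2 + t / 2 by field.
rewrite (expmxDZ D) det_mulmx.
have /(congr1 determinant) := expmx_skew (t / 2) XJ.
rewrite !det_mulmx det_tr mulrAC -{2}[\det J]mul1r; apply: mulIf.
have /(congr1 determinant) := JJ; rewrite det_mulmx det1 => JJ1.
by apply/eqP => J0; move/eqP: JJ1; rewrite J0 mul0r eq_sym oner_eq0.
Qed.

Lemma skew_of_expmx X :
  (forall t, (expmx (iota t *: X))^T *m J *m expmx (iota t *: X) = J) ->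
  skew_J X.
Proof.
move=> XJ; rewrite /skew_J.
pose q t : 'M[F]_n := (iota t)^-1 *: (expmx (iota t *: X) - 1%:M).
have qX : q t @[t --> (0 : R)^'] --> X := expmx_derivative0 D X.
pose e t : 'M[F]_n := expmx (iota t *: X).
have e1 : e t @[t --> (0 : R)^'] --> (1%:M : 'M[F]_n).
  rewrite -(expmx0 D n) -(scale0r X) -(rmorph0 iota).
  apply: cvg_within_filter; exact: (continuous_expmx D).
(* By the product rule this is the difference quotient of e^T J e, which is 0 for every t because
   e^T J e is constantly [J]. *)
have h : ((q t)^T *m J *m e t + J *m q t) @[t --> (0 : R)^'] -->
    X^T *m J *m 1%:M + J *m X.
  apply: cvg_mxD.
    apply: cvg_mulmx => //; apply: cvg_mulmx; last exact: cvg_cst.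
    exact: cvg_trmx.
  by apply: cvg_mulmx => //; exact: cvg_cst.
rewrite mulmx1 in h; apply: cvg_mx_unique h _.
apply: cvg_near_cst; apply: nearW => t; rewrite /q /e.
rewrite linearZ/= linearB/= trmx1 -scalemxAl -scalemxAl -scalemxAr -scalerDr.
rewrite !mulmxBl mul1mx XJ mulmxBr mulmx1 addrA subrK subrr scaler0.
by [].
Qed.

Context (G : set 'M[F]_n) (theta : 'M[F]_n -> 'M[F]_n).
Hypotheses (GJ : forall A, G A -> A^T *m J *m A = J)
  (Gexp : forall X, skew_J X -> lie_algebra iota G X)
  (Gtheta : forall A, G A -> theta A = J *m conjmx A *m J).

Lemma lie_algebraP X : lie_algebra iota G X <-> skew_J X.
Proof. by split => [GX|]; [apply: skew_of_expmx => t; exact: GJ|exact: Gexp]. Qed.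

Lemma conjmx_herm_skew X : skew_J X -> adjmx X = X -> J *m conjmx X *m J = - X.
Proof.
move=> /skew_JE XJ Xh; rewrite -[conjmx X]trmxK -adjmxE Xh XJ.
by rewrite mulmxN mulNmx !mulmxA JJ mul1mx -mulmxA JJ mulmx1.
Qed.

(** The differential of [theta] is X |-> J (conj X) J; on a J-skew X this equals minus the adjoint,
    so the eigenvalue -1 means hermitian. *)
Lemma cartan_sP X : cartan_s iota G theta X <-> skew_J X /\ adjmx X = X.
Proof.
have dtheta : lie_algebra iota G X ->
    differential_at1 iota theta X (J *m conjmx X *m J).
  move=> GX; rewrite /differential_at1.
  have E t : (iota t)^-1 *: (theta (expmx (iota t *: X)) - 1%:M) =
      J *m conjmx ((iota t)^-1 *: (expmx (iota t *: X) - 1%:M)) *m J.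
    rewrite (Gtheta (GX t)) conjmxZ fmorphV cj_iota -scalemxAr -scalemxAl.
    by rewrite conjmxD conjmxN conjmx1 mulmxBr mulmxBl mulmx1 JJ.
  under eq_fun do rewrite E.
  apply: cvg_mulmx; last exact: cvg_cst.
  apply: cvg_mulmx; first exact: cvg_cst.
  by apply: cvg_conjmx; exact: expmx_derivative0.
split => [[GX dX]|[XJ Xh]].
  have XJ := (lie_algebraP X).1 GX; split => //.
  have : J *m conjmx X *m J = - X by apply: cvg_mx_unique (dtheta GX) dX.
  move=> /(congr1 (fun Y => J *m Y *m J)).
  rewrite !mulmxA JJ mul1mx -mulmxA JJ mulmx1 => cX.
  by rewrite adjmxE cX mulmxN mulNmx -(skew_JE X).1// trmxK.
split; first exact: Gexp.
by have := dtheta (Gexp XJ); rewrite conjmx_herm_skew.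
Qed.

End OrthogonalLie.

(** * The real and the complex scalars *)

Section ScalarInstances.
Variable R : realType.

Program Definition real_scalars : @conj_scalars R R idfun :=
  @ConjScalars R R idfun idfun (real_complex R) _ _ _ _ _.
Next Obligation. by move=> x; rewrite conjc_real. Qed.
Next Obligation. by []. Qed.
Next Obligation.
by move=> x /=; rewrite normc_def /= expr0n/= addr0 sqrtr_sqr.
Qed.
Next Obligation.
move=> u cu _; exists (limn u); split => //=.
by rewrite lim_cst.
Qed.
Next Obligation. by move=> x _; exists x. Qed.

Program Definition complex_scalars : @conj_scalars R R[i] (real_complex R) :=
  @ConjScalars R R[i] (real_complex R) (@conjc R) idfun _ _ _ _ _.
Next Obligation. by []. Qed.
Next Obligation. by []. Qed.
Next Obligation. by []. Qed.
Next Obligation.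
move=> u _ _.
exists (Complex (limn (fun k => complex.Re (u k))) (limn (fun k => complex.Im (u k)))).
by [].
Qed.
Next Obligation.
move=> [a b] [ba]; exists a; congr Complex; lra.
Qed.

End ScalarInstances.

(** * Common eigenvectors of commuting hermitian matrices *)

Section JointEigenvectors.
Context (R : realType) (F : numFieldType) (iota : {rmorphism R -> F}).
Context (D : conj_scalars iota) (n : nat).

(** [M] is the matrix of [H] on the row space of [U], in a basis that need not be orthonormal. It
    has an eigenvalue over [R[i]]; the corresponding eigenvector of [H] shows that it is real, and
    being an eigenvalue descends from [R[i]] to [F]. *)
Lemma herm_eigenvalue m (M : 'M[F]_m) (U : 'M[F]_(m, n)) (H : 'M[F]_n) :
  (0 < m)%N -> row_free U -> adjmx D H = H -> U *m H = M *m U ->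
  exists r, eigenvalue M (iota r).
Proof.
move=> m0 Ufree Hh UH.
have [a /eigenvalueP[x xM x0]] := eigenvalue_closed (map_mx (toC D) M) m0.
pose y := x *m map_mx (toC D) U.
have y0 : y != 0 by rewrite /y mulmx_free_eq0 ?/row_free ?mxrank_map.
have yH : y *m map_mx (toC D) H = a *: y.
  by rewrite /y -mulmxA -map_mxM UH map_mxM mulmxA xM scalemxAl.
pose DC := complex_scalars R.
have Hadj : adjmx DC (map_mx (toC D) H) = map_mx (toC D) H.
  by rewrite -[in RHS]Hh; apply/matrixP => i j; rewrite !mxE toC_cj.
have yy : y *m adjmx DC y != 0.
  apply/eqP => yy; move/eqP: y0; apply; rewrite -(adjmxK DC y).
  have -> : adjmx DC y = 0; last exact: adjmx0.
  by apply: (@adj_self_eq0 _ _ _ DC); rewrite adjmxK.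
have ca : conjc a = a.
  have : y *m map_mx (toC D) H *m adjmx DC y = conjc a *: (y *m adjmx DC y).
    by rewrite -[in LHS]Hadj -mulmxA -adjmxM yH adjmxZ -scalemxAr.
  rewrite yH -scalemxAl => /eqP; rewrite -subr_eq0 -scalerBl scaler_eq0 (negPf yy).
  by rewrite orbF subr_eq0 eq_sym => /eqP.
have [r ar] := cj_fixed (ca : cj DC a = a).
exists r; rewrite -(eigenvalue_map (toC D)) toC_iota -ar.
by apply/eigenvalueP; exists x.
Qed.

Context (S : set 'M[F]_n).
Hypotheses (S_herm : forall H, S H -> adjmx D H = H)
  (S_comm : forall H H', S H -> S H' -> H *m H' = H' *m H).

(** Induction on the rank: either every member of [S] acts on [W] by a real scalar, or some [H] has
    an eigenspace that cuts [W] down properly, and commutation keeps the intersection stable. *)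
Lemma joint_eigenvector m (W : 'M[F]_(m, n)) :
  W != 0 -> (forall H, S H -> (W *m H <= W)%MS) ->
  exists v : 'rV[F]_n, [/\ v != 0, (v <= W)%MS &
    forall H, S H -> exists r, v *m H = iota r *: v].
Proof.
have [k] := ubnP (\rank W); elim: k m W => // k IH m W; rewrite ltnS => Wk W0 Wst.
have [scal|] := pselect (forall H, S H -> exists r, W *m H = iota r *: W).
  exists (nz_row W); split; [by rewrite nz_row_eq0|exact: nz_row_sub|].
  move=> H SH; have [r Wr] := scal _ SH; exists r.
  have /submxP[u ->] := nz_row_sub W.
  by rewrite -mulmxA Wr -scalemxAr.
move=> /existsNP[H /not_implyP[SH nscal]].
pose U := row_base W; pose M := U *m H *m pinvmx U.
have UH : U *m H = M *m U.
  rewrite /M mulmxKpV// eq_row_base.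
  by rewrite (submx_trans (submxMr _ _) (Wst _ SH))// eq_row_base.
have Wr0 : (0 < \rank W)%N by rewrite lt0n mxrank_eq0.
have [r /eigenvalueP[x xM x0]] :=
  herm_eigenvalue Wr0 (row_base_free W) (S_herm SH) UH.
pose W' := (W :&: eigenspace H (iota r))%MS.
have W'0 : W' != 0.
  have : x *m U != 0 by rewrite mulmx_free_eq0 ?row_base_free.
  apply: contra_neq => W'0; apply/eqP; rewrite -submx0 -W'0 sub_capmx.
  rewrite (submx_trans (submxMl _ _)) ?eq_row_base//=.
  by apply/eigenspaceP; rewrite -mulmxA UH mulmxA xM scalemxAl.
have W'k : (\rank W' < k)%N.
  apply: leq_trans Wk; rewrite ltn_neqAle mxrankS ?capmxSl// andbT.
  apply/negP => rk; apply: nscal; exists r; apply/eigenspaceP.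
  have WW' : (W <= W')%MS.
    by rewrite -(geq_leqif (mxrank_leqif_sup (capmxSl _ _))) (eqP rk).
  exact: submx_trans WW' (capmxSr _ _).
have [|v [v0 vW' vS]] := IH _ W' W'k W'0.
  move=> H' SH'; rewrite sub_capmx.
  rewrite (submx_trans (submxMr _ (capmxSl _ _)) (Wst _ SH'))/=.
  apply/eigenspaceP; have /eigenspaceP E : (W' <= eigenspace H (iota r))%MS.
    exact: capmxSr.
  by rewrite -mulmxA (S_comm SH' SH) mulmxA E scalemxAl.
by exists v; split => //; exact: submx_trans vW' (capmxSl _ _).
Qed.

End JointEigenvectors.

(** * Unit vectors and the fork of type D *)

Section Fork.
Context (K : realFieldType) (V : zmodType) (b : V -> V -> K).
Hypotheses (bDl : forall x y z, b (x + y) z = b x z + b y z)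
  (bC : forall x y, b x y = b y x).
Context (A U : set V).
Hypotheses (AD : forall x y, A x -> A y -> A (x + y))
  (b_def : forall x, A x -> b x x = 0 -> x = 0)
  (UA : U `<=` A) (UN : forall e, U e -> U (- e))
  (U1 : forall e, U e -> b e e = 1)
  (U01 : forall e e', U e -> U e' -> [\/ b e e' = 0, b e e' = 1 | b e e' = -1]).

Let bNl x z : b (- x) z = - b x z.
Proof.
have b0 : b 0 z = 0 by have := bDl 0 0 z; rewrite addr0; lra.
by have := bDl x (- x) z; rewrite subrr b0; lra.
Qed.
Let bDr x y z : b z (x + y) = b z x + b z y.
Proof. by rewrite bC bDl !(bC z). Qed.
Let bNr x z : b z (- x) = - b z x.
Proof. by rewrite bC bNl bC. Qed.

Lemma unit_eq e e' : U e -> U e' -> b e e' = 1 -> e = e'.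
Proof.
move=> Ue Ue' ee'; apply/eqP; rewrite -subr_eq0; apply/eqP/b_def.
  by apply: AD; [exact: UA | exact/UA/UN].
by rewrite bDl !bDr !bNl !bNr (bC e') !U1// ee'; lra.
Qed.

(** [U] stands for the vectors e_i and - e_i, so these are the roots of type D, sums and differences
    of e_i and e_j with i different from j. *)
Definition orthogonal_sum d := exists x y, [/\ U x, U y, b x y = 0 & d = x + y].

(** If one summand is [e] or [- e], the other is orthogonal to [e]; so the two coefficients never
    add up. *)
Lemma orthogonal_sum_coef d e : orthogonal_sum d -> U e ->
  [\/ b d e = 0, b d e = 1 | b d e = -1].
Proof.
move=> [x [y [Ux Uy xy ->]]] Ue; rewrite bDl.
have [xe|xe|xe] := U01 Ux Ue; rewrite xe.
- by rewrite add0r; exact: U01.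
- by rewrite -(unit_eq Ux Ue xe) bC xy addr0; constructor 2.
- have <- : - x = e by apply: unit_eq; rewrite ?bNl ?xe ?opprK//; exact: UN.
  by rewrite bNr bC xy oppr0 addr0; constructor 3.
Qed.

Lemma orthogonal_sum_sub d e : orthogonal_sum d -> U e -> b d e = 1 ->
  U (d - e) /\ b (d - e) e = 0.
Proof.
move=> [x [y [Ux Uy xy ->]]] Ue; rewrite bDl.
have [xe|xe|xe] := U01 Ux Ue; have [ye|ye|ye] := U01 Uy Ue; rewrite xe ye;
  try by move=> h; exfalso; lra.
- by rewrite (unit_eq Uy Ue ye) addrK xe.
- by rewrite (unit_eq Ux Ue xe) [e + y]addrC addrK ye.
Qed.

Lemma orthogonal_sum_add d e : orthogonal_sum d -> U e -> b d e = -1 ->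
  U (d + e) /\ b (d + e) e = 0.
Proof.
move=> dS Ue de; have [] := orthogonal_sum_sub dS (UN Ue).
  by rewrite bNr de opprK.
by rewrite opprK bNr => ? /eqP; rewrite oppr_eq0 => /eqP.
Qed.

Lemma orthogonal_sum_diff d x y : orthogonal_sum d -> U x -> U y -> b y x = 0 ->
  b d y = 1 -> b d x = -1 -> d = y - x.
Proof.
move=> dS Ux Uy yx dy dx; have [Udy _] := orthogonal_sum_sub dS Uy dy.
have E : d - y = - x.
  by apply: unit_eq => //; [exact: UN|rewrite bNr bDl bNl dx yx; lra].
by rewrite -[d](subrK y) E addrC.
Qed.

(* A fifth simple root is incompatible with the triality-twisted position of the
   fork: this is where [r >= 5] is used. *)
Lemma fork_difference d1 d2 d3 d4 d5 :
  orthogonal_sum d1 -> orthogonal_sum d2 -> orthogonal_sum d3 ->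
  orthogonal_sum d4 -> orthogonal_sum d5 ->
  b d1 d2 = 0 -> b d1 d3 = -1 -> b d2 d3 = -1 -> b d4 d3 = -1 ->
  b d4 d1 = 0 -> b d4 d2 = 0 -> b d5 d4 = -1 -> b d5 d1 = 0 -> b d5 d2 = 0 ->
  exists2 x, U x & d1 - d2 = x + x.
Proof.
move=> S1 S2 S3 S4 S5 e12 e13 e23 e43 e41 e42 e54 e51 e52.
(* The coefficients of [d3] at the two summands of [d1] add up to -1, hence are 0 and -1 in some
   order. The goal is the normal form d1 = x + y, d3 = z - y. *)
have [x [y [Ux Uy xy E1 [x3 y3]]]] : exists x y,
    [/\ U x, U y, b x y = 0, d1 = x + y & b d3 x = 0 /\ b d3 y = -1].
  have [x [y [Ux Uy xy E1]]] := S1.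
  move: e13; rewrite E1 bDl (bC x) (bC y).
  have [x3|x3|x3] := orthogonal_sum_coef S3 Ux;
  have [y3|y3|y3] := orthogonal_sum_coef S3 Uy; rewrite x3 y3 => h;
    try by exfalso; lra.
  - by exists x, y.
  - by exists y, x; split; rewrite // 1?bC// addrC.
have [Uz zy] := orthogonal_sum_add S3 Uy y3.
set z := d3 + y in Uz zy.
have E3 : d3 = z - y by rewrite /z addrK.
have zx : b z x = 0 by rewrite /z bDl x3 (bC y) xy addr0.
have yx : b y x = 0 by rewrite bC.
clearbody z; move: e23 e43; rewrite E3 !bDr !bNr => e23 e43.
rewrite E1 bDr in e41; rewrite E1 bDr in e51; rewrite E1 bDl !(bC _ d2) in e12.
(* As b d2 z - b d2 y = -1, either d2 = y - x, the classical fork, or d2 = q - z. *)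
have [z2|z2|z2] := orthogonal_sum_coef S2 Uz;
have [y2|y2|y2] := orthogonal_sum_coef S2 Uy; rewrite z2 y2 in e23;
  try by exfalso; lra.
  have E2 : d2 = y - x by apply: orthogonal_sum_diff => //; lra.
  by exists x => //; rewrite E1 E2 opprB addrACA subrr addr0.
(* In the chain x + y, z - y, q - z, the vector [d4] must be y - x or - z - q, so that [d4] forms a
   classical fork with [d1] or [d2]. Then [d5], linked to [d4] and orthogonal to [d1] and [d2],
   would have the coefficient 1/2 at x or at z. *)
exfalso; have [Uq qz] := orthogonal_sum_add S2 Uz z2.
set q := d2 + z in Uq qz.
have E2 : d2 = q - z by rewrite /q addrK.
clearbody q; rewrite E2 bDr bNr in e42; rewrite E2 bDr bNr in e52.
have [z4|z4|z4] := orthogonal_sum_coef S4 Uz;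
have [y4|y4|y4] := orthogonal_sum_coef S4 Uy; rewrite z4 y4 in e43;
  try by exfalso; lra.
- have E4 : d4 = y - x by apply: orthogonal_sum_diff => //; lra.
  rewrite E4 bDr bNr in e54.
  have [|//|] := orthogonal_sum_coef S5 Ux; lra.
- have E4 : d4 = - z - q.
    apply: orthogonal_sum_diff => //; rewrite ?bNr ?bNl; try exact: UN.
    + by rewrite bC qz oppr0.
    + by rewrite z4 opprK.
    + by move: e42; rewrite z4; lra.
  rewrite E4 bDr !bNr in e54.
  have [|//|] := orthogonal_sum_coef S5 Uz; lra.
Qed.

End Fork.

(** * Rank-one matrices and the hermitian product *)

Section OuterProducts.
Context (R : realType) (F : numFieldType) (iota : {rmorphism R -> F}).
Context (D : conj_scalars iota) (n : nat).
Implicit Types (x y z t : 'cV[F]_n) (H : 'M[F]_n).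
Local Notation adjmx := (adjmx D).

Definition ip x y : F := (adjmx x *m y) 0 0.
Definition outer x y : 'M[F]_n := x *m adjmx y.

Lemma outerE x y : outer x y = x *m adjmx y. Proof. by []. Qed.

Lemma ipE x y : adjmx x *m y = (ip x y)%:M.
Proof. exact: mx11_scalar. Qed.

Lemma outer_mulv x y z : outer x y *m z = ip y z *: x.
Proof. by rewrite /outer -mulmxA ipE mul_mx_scalar. Qed.

Lemma outerM x y z t : outer x y *m outer z t = ip y z *: outer x t.
Proof. by rewrite {2}/outer mulmxA outer_mulv -scalemxAl. Qed.

Lemma mul_outer H x y : H *m outer x y = outer (H *m x) y.
Proof. exact: mulmxA. Qed.

Lemma outer_mul H x y : outer x y *m H = outer x (adjmx H *m y).
Proof. by rewrite /outer adjmxM adjmxK mulmxA. Qed.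

Lemma adj_outer x y : adjmx (outer x y) = outer y x.
Proof. by rewrite /outer adjmxM adjmxK. Qed.

Lemma tr_outer x y : \tr (outer x y) = ip y x.
Proof. by rewrite /outer mxtrace_mulC ipE mxtrace_scalar. Qed.

Lemma outerDl x y z : outer (x + y) z = outer x z + outer y z.
Proof. exact: mulmxDl. Qed.
Lemma outerDr x y z : outer x (y + z) = outer x y + outer x z.
Proof. by rewrite /outer adjmxD mulmxDr. Qed.
Lemma outerNl x y : outer (- x) y = - outer x y.
Proof. exact: mulNmx. Qed.
Lemma outerNr x y : outer x (- y) = - outer x y.
Proof. by rewrite /outer adjmxN mulmxN. Qed.
Lemma outerZl s x y : outer (s *: x) y = s *: outer x y.
Proof. by rewrite /outer -scalemxAl. Qed.
Lemma outerZr s x y : outer x (s *: y) = cj D s *: outer x y.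
Proof. by rewrite /outer adjmxZ -scalemxAr. Qed.

Lemma outer_polarize x y :
  outer (x - y) (x + y) + outer (x + y) (x - y) = 2 *: (outer x x - outer y y).
Proof.
rewrite !outerDl !outerDr !outerNl !outerNr.
move: (outer x x) (outer x y) (outer y x) (outer y y) => p q r s.
by apply/matrixP => i j; rewrite !mxE; ring.
Qed.

Lemma ipDl x y z : ip (x + y) z = ip x z + ip y z.
Proof. by rewrite /ip adjmxD mulmxDl mxE. Qed.
Lemma ipDr x y z : ip x (y + z) = ip x y + ip x z.
Proof. by rewrite /ip mulmxDr mxE. Qed.
Lemma ipNr x y : ip x (- y) = - ip x y.
Proof. by rewrite /ip mulmxN mxE. Qed.
Lemma ipNl x y : ip (- x) y = - ip x y.
Proof. by rewrite /ip adjmxN mulNmx mxE. Qed.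
Lemma ipZr s x y : ip x (s *: y) = s * ip x y.
Proof. by rewrite /ip -scalemxAr mxE. Qed.
Lemma ipZl s x y : ip (s *: x) y = cj D s * ip x y.
Proof. by rewrite /ip adjmxZ -scalemxAl mxE. Qed.

Lemma ip_cj x y : cj D (ip x y) = ip y x.
Proof.
have : adjmx (adjmx x *m y) = adjmx y *m x by rewrite adjmxM adjmxK.
by rewrite /ip => /matrixP/(_ 0 0) <-; rewrite [RHS]mxE [RHS]mxE.
Qed.

Lemma ip_conj x y : ip (conjmx D x) (conjmx D y) = cj D (ip x y).
Proof.
rewrite /ip; have -> : adjmx (conjmx D x) *m conjmx D y = conjmx D (adjmx x *m y).
  by rewrite conjmxM !adjmxE conj_trmx.
by rewrite mxE.
Qed.

Lemma ip0r x : ip x 0 = 0.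
Proof. by rewrite /ip mulmx0 mxE. Qed.

Lemma ip_mull H x y : ip (H *m x) y = ip x (adjmx H *m y).
Proof. by rewrite /ip adjmxM mulmxA. Qed.

Lemma ip_eq0 x : ip x x = 0 -> x = 0.
Proof.
move=> x0; apply: (@adj_self_eq0 _ _ _ D); rewrite ipE x0.
by apply/matrixP => i j; rewrite !mxE mul0rn.
Qed.

End OuterProducts.

(** * Weights of the abelian subspace and the reflection attached to one *)

Section WeightVectors.
Context (R : realType) (F : numFieldType) (iota : {rmorphism R -> F}).
Context (D : conj_scalars iota) (n : nat) (J : 'M[F]_n).
Local Notation conjmx := (conjmx D).
Local Notation adjmx := (adjmx D).
Local Notation ip := (ip D).
Local Notation outer := (outer D).
Implicit Types (v w x : 'cV[F]_n) (l : 'M[F]_n -> R) (H : 'M[F]_n).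

Hypotheses (J_tr : J^T = J) (JJ : J *m J = 1%:M) (J_conj : conjmx J = J).

Context (a : set 'M[F]_n).
Hypotheses (a_skew : forall H, a H -> skew_J J H)
  (a_herm : forall H, a H -> adjmx H = H)
  (a_comm : forall H H', a H -> a H' -> H *m H' = H' *m H)
  (a_sub : real_subspace iota a)
  (a_max : forall H, skew_J J H -> adjmx H = H ->
     (forall H', a H' -> H' *m H = H *m H') -> a H).

Lemma a0 : a 0. Proof. by case: a_sub. Qed.

Lemma aDZ t H H' : a H -> a H' -> a (iota t *: H + H').
Proof. by case: a_sub => _; apply. Qed.

Lemma aD H H' : a H -> a H' -> a (H + H').
Proof. by move=> aH aH'; rewrite -[H]scale1r -(rmorph1 iota); exact: aDZ. Qed.

Lemma aN H : a H -> a (- H).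
Proof.
move=> aH; have := aDZ (-1) aH a0.
by rewrite addr0 rmorphN rmorph1 scaleN1r.
Qed.

Lemma aB H H' : a H -> a H' -> a (H - H').
Proof. by move=> aH aH'; apply: aD => //; exact: aN. Qed.

(* tau is the antilinear involution exchanging the weights l and - l. *)
Definition tau v : 'cV[F]_n := J *m conjmx v.

Lemma tauK v : tau (tau v) = v.
Proof. by rewrite /tau conjmxM conjmxK J_conj mulmxA JJ mul1mx. Qed.

Lemma adj_J : adjmx J = J.
Proof. by rewrite adjmxE J_conj. Qed.

Lemma ip_tau v w : ip (tau v) (tau w) = ip w v.
Proof.
by rewrite /tau ip_mull adj_J mulmxA JJ mul1mx ip_conj ip_cj.
Qed.

Lemma conj_outer_tau v w : J *m conjmx (outer v w) *m J = outer (tau v) (tau w).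
Proof.
by rewrite !outerE conjmxM /tau adjmxM adj_J !mulmxA !adjmxE conj_trmx.
Qed.

Definition weight_vector v l :=
  v != 0 /\ forall H, a H -> H *m v = iota (l H) *: v.

Lemma weight_vector_tau v l :
  weight_vector v l -> weight_vector (tau v) (fun H => - l H).
Proof.
move=> [v0 vl]; split.
  by apply: contra_neq v0 => tv; rewrite -(tauK v) tv /tau conjmx0 mulmx0.
move=> H aH; have JHJ := conjmx_herm_skew JJ (a_skew aH) (a_herm aH).
have HE : H = - (J *m conjmx H *m J) by rewrite JHJ opprK.
rewrite {1}HE mulNmx -!mulmxA /tau (mulmxA J J) JJ mul1mx -conjmxM vl//.
by rewrite conjmxZ cj_iota -scalemxAr rmorphN scaleNr.
Qed.

Lemma weight_ip v l w l' H : weight_vector v l -> weight_vector w l' -> a H ->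
  l H != l' H -> ip v w = 0.
Proof.
move=> [_ vl] [_ wl] aH ll'.
have : ip (H *m v) w = ip v (H *m w) by rewrite ip_mull a_herm.
rewrite vl// wl// ipZl ipZr cj_iota => /eqP.
rewrite -subr_eq0 -mulrBl -rmorphB mulf_eq0 fmorph_eq0 subr_eq0 (negPf ll').
by move=> /eqP.
Qed.

Section OneWeight.
Context v l (vl : weight_vector v l) (H1 : 'M[F]_n) (aH1 : a H1) (lH1 : l H1 != 0).

Let c := ip v v.
Let tv := tau v.
Let vlH : forall H, a H -> H *m v = iota (l H) *: v. Proof. by case: vl. Qed.
Let tvlH : forall H, a H -> H *m tv = - iota (l H) *: tv.
Proof.
by move=> H aH; case: (weight_vector_tau vl) => _ ->; rewrite // rmorphN.
Qed.

Lemma weight_c_neq0 : c != 0.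
Proof. by apply/eqP => /ip_eq0; case: vl => /eqP. Qed.

Lemma weight_cj_c : cj D c = c. Proof. exact: ip_cj. Qed.

Lemma ip_v_tau : ip v tv = 0.
Proof.
apply: (weight_ip vl (weight_vector_tau vl) aH1).
by rewrite -subr_eq0 opprK -mulr2n mulrn_eq0.
Qed.

Lemma ip_tau_v : ip tv v = 0.
Proof. by rewrite -ip_cj ip_v_tau rmorph0. Qed.

Let ip_tt : ip tv tv = c. Proof. exact: ip_tau. Qed.

(** This is [E_l]: for nonzero [l] it is 1 on v, -1 on tau v, and 0 on the orthogonal complement of
    both. *)
Definition coroot : 'M[F]_n := c^-1 *: (outer v v - outer tv tv).

Lemma coroot_v : coroot *m v = v.
Proof.
rewrite /coroot -scalemxAl mulmxBl !outer_mulv ip_tau_v scale0r subr0.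
by rewrite scalerA mulVf ?scale1r ?weight_c_neq0.
Qed.

Lemma coroot_tau : coroot *m tv = - tv.
Proof.
rewrite /coroot -scalemxAl mulmxBl !outer_mulv ip_v_tau scale0r sub0r scalerN.
by rewrite ip_tt scalerA mulVf ?scale1r ?weight_c_neq0.
Qed.

(** Encodes that the eigenvalues are 0, 1, -1 by an equation; evaluated on another weight vector it
    shows that weights take only these values on [E_l], which is the orthogonality of weights up to
    sign. *)
Lemma coroot_cube : coroot *m coroot *m coroot = coroot.
Proof.
have E2 : coroot *m coroot = c^-1 *: (outer v v + outer tv tv).
  rewrite {2}/coroot -scalemxAr mulmxBr !mul_outer coroot_v coroot_tau.
  by rewrite outerNl opprK.
rewrite -mulmxA E2 -scalemxAr mulmxDr !mul_outer coroot_v coroot_tau.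
by rewrite outerNl.
Qed.

Lemma coroot_herm : adjmx coroot = coroot.
Proof.
by rewrite /coroot adjmxZ adjmxD adjmxN !adj_outer fmorphV weight_cj_c.
Qed.

Lemma coroot_skew : skew_J J coroot.
Proof.
have key : J *m conjmx coroot *m J = - coroot.
  rewrite /coroot conjmxZ -!scalemxAr -!scalemxAl fmorphV weight_cj_c.
  rewrite conjmxD conjmxN mulmxBr mulmxBl !conj_outer_tau.
  by rewrite /tv tauK -scalerN opprB.
apply/(skew_JE JJ); rewrite (trmx_adj D) coroot_herm -mulNmx -mulmxN.
by rewrite -key !mulmxA JJ mul1mx -mulmxA JJ mulmx1.
Qed.

Lemma a_coroot : a coroot.
Proof.
apply: a_max; [exact: coroot_skew | exact: coroot_herm |] => H aH.
rewrite /coroot -scalemxAl -scalemxAr mulmxBr mulmxBl !mul_outer !outer_mul.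
rewrite a_herm// !vlH// !tvlH// !outerZl !outerZr rmorphN cj_iota.
by [].
Qed.

Lemma tr_coroot H : a H -> \tr (H *m coroot) = iota (2 * l H).
Proof.
move=> aH; rewrite /coroot -scalemxAr mulmxBr !mul_outer vlH// tvlH//.
rewrite !outerZl scaleNr opprK linearZ/= linearD/= !linearZ/= !tr_outer ip_tt.
rewrite -mulrDl mulrCA mulVf ?weight_c_neq0// mulr1 rmorphM rmorph_nat.
by rewrite mulr2n mulrDl !mul1r.
Qed.

Lemma weight_coroot1 : l coroot = 1.
Proof.
have := vlH a_coroot; rewrite coroot_v => /eqP.
rewrite -{1}[v]scale1r -subr_eq0 -scalerBl scaler_eq0.
case: vl => /negPf -> _; rewrite orbF subr_eq0 -(rmorph1 iota).
by move=> /eqP/fmorph_inj.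
Qed.

(** The constant is 2 / (2 c): for nonzero [l], v and tau v are orthogonal of the same squared
    length c. *)
Definition weight_reflection : 'M[F]_n := 1%:M - c^-1 *: outer (v + tv) (v + tv).
Local Notation u := (v + tv).
Local Notation s := weight_reflection.

Let ip_uu : ip u u = 2 * c.
Proof.
rewrite ipDl !ipDr ip_v_tau ip_tau_v ip_tt addr0 add0r -/c.
by rewrite mulr2n mulrDl !mul1r.
Qed.

Lemma weight_reflectionK : s *m s = 1%:M.
Proof.
rewrite /s mulmxBl mul1mx mulmxBr mulmx1 -scalemxAl -scalemxAr outerM ip_uu.
move: (outer u u) => U; apply/matrixP => i j; rewrite !mxE.
by field; exact: weight_c_neq0.
Qed.

Lemma weight_reflection_herm : adjmx s = s.
Proof.
rewrite /s adjmxD adjmxN adjmxZ fmorphV weight_cj_c adj_outer.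
by rewrite adjmx1.
Qed.

Lemma weight_reflection_conj : J *m conjmx s *m J = s.
Proof.
rewrite /s conjmxD conjmxN conjmxZ fmorphV weight_cj_c conjmx1 mulmxBr mulmxBl.
rewrite mulmx1 JJ -scalemxAr -scalemxAl conj_outer_tau.
have -> : tau u = u by rewrite {1}/tau conjmxD mulmxDr -/(tau v) -/(tau tv) tauK addrC.
by [].
Qed.

(** With u = v + tau v, [H] sends u to l(H) (v - tau v), which is orthogonal to u. So the term
    quadratic in the projection vanishes, and the two cross terms polarize to a multiple of
    [coroot]. *)
Lemma weight_reflection_a H : a H -> s *m H *m s = H - iota (2 * l H) *: coroot.
Proof.
move=> aH.
have Hu : H *m u = iota (l H) *: (v - tv).
  by rewrite mulmxDr vlH// tvlH// scaleNr -scalerBr.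
have up : ip u (v - tv) = 0.
  rewrite ipDl !ipDr !ipNr ip_v_tau ip_tau_v ip_tt oppr0 addr0 add0r.
  exact: subrr.
have uHu : ip u (H *m u) = 0 by rewrite Hu ipZr up mulr0.
rewrite /s mulmxBl mul1mx mulmxBr mulmx1 -scalemxAl outer_mul a_herm//.
rewrite mulmxBl -scalemxAr mul_outer -scalemxAl -scalemxAr outerM.
rewrite ip_mull a_herm// uHu !scale0r !scaler0 subr0 Hu outerZl outerZr cj_iota.
rewrite -addrA -opprD -!scalerDr [outer u _ + _]addrC outer_polarize.
rewrite /coroot !scalerA rmorphM rmorph_nat; congr (_ - _ *: _).
by ring.
Qed.

End OneWeight.

(** * Roots as differences of weights *)

Lemma weight_vector_in m (W : 'M[F]_(m, n)) : W != 0 ->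
  (forall H, a H -> (W *m H <= W)%MS) ->
  exists v l, weight_vector v l /\ (adjmx v <= W)%MS.
Proof.
move=> W0 Wst; have [z [z0 zW zS]] := joint_eigenvector a_herm a_comm W0 Wst.
(* The eigenvalues are chosen as a function on all matrices, with the value 0 outside [a]. *)
have [l zl] : {l : 'M[F]_n -> R & forall H, a H -> z *m H = iota (l H) *: z}.
  apply: (@choice _ _ (fun H r => a H -> z *m H = iota r *: z)) => H.
  have [aH|naH] := pselect (a H); last by exists 0 => /naH.
  by have [r zr] := zS _ aH; exists r.
exists (adjmx z), l; split; last by rewrite adjmxK.
split; first by rewrite adjmx_eq0.
by move=> H aH; rewrite -{1}(a_herm aH) -adjmxM zl// adjmxZ cj_iota.
Qed.

Lemma weight_vector_mul X v l beta :
  weight_vector v l -> X *m v != 0 ->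
  (forall H, a H -> lie_bracket H X = iota (beta H) *: X) ->
  weight_vector (X *m v) (fun H => beta H + l H).
Proof.
move=> [_ vl] Xv0 XH; split => // H aH.
have -> : H *m (X *m v) = lie_bracket H X *m v + X *m (H *m v).
  by rewrite /lie_bracket mulmxBl !mulmxA subrK.
by rewrite XH// (vl H)// -scalemxAl -scalemxAr -scalerDl rmorphD.
Qed.

(** The row space of [X] is stable under [a], as X H = (H - beta(H)) X, so it contains the adjoint
    of a weight vector w. If X w were 0, then w would have length 0; hence X w is a weight vector,
    of weight beta + l'. *)
Lemma root_weights X beta : X != 0 ->
  (forall H, a H -> lie_bracket H X = iota (beta H) *: X) ->
  exists v l w l', [/\ weight_vector v l, weight_vector w l' &
    forall H, a H -> beta H = l H - l' H].
Proof.
move=> X0 XH.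
have [H aH|w [l' [wl' /submxP[z wz]]]] := weight_vector_in X0.
  have -> : X *m H = (H - (iota (beta H))%:M) *m X.
    by rewrite mulmxBl mul_scalar_mx -XH// /lie_bracket opprB addrC subrK.
  exact: submxMl.
have Xw0 : X *m w != 0.
  apply/eqP => Xw; have := wl'.1 => /eqP; apply.
  by apply: (@adj_self_eq0 _ _ _ D); rewrite wz -mulmxA Xw mulmx0.
exists (X *m w), (fun H => beta H + l' H), w, l'; split => //.
  exact: weight_vector_mul.
by move=> H aH; rewrite addrK.
Qed.

(** Half the trace form, real on [a]: in this scale [E_l] represents [l] itself and has length 1. *)
Definition form H H' : R := complex.Re (toC D (\tr (H *m H'))) / 2.

Lemma formE H H' : a H -> a H' -> \tr (H *m H') = iota (2 * form H H').
Proof.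
move=> aH aH'.
have [t trE] : exists t, \tr (H *m H') = iota t.
  apply: (@cj_fixed _ _ _ D).
  have -> : cj D (\tr (H *m H')) = \tr (adjmx (H *m H')).
    by rewrite mxtrace_adj.
  by rewrite adjmxM !a_herm// mxtrace_mulC.
by rewrite /form trE toC_iota/=; congr (iota _); field.
Qed.

Lemma formDl H H' H'' : form (H + H') H'' = form H H'' + form H' H''.
Proof.
rewrite /form mulmxDl linearD/= rmorphD -mulrDl; congr (_ / _).
by move: (toC D _) (toC D _) => [p q] [p' q'].
Qed.

Lemma formC H H' : form H H' = form H' H.
Proof. by rewrite /form mxtrace_mulC. Qed.

Lemma form_def H : a H -> form H H = 0 -> H = 0.
Proof.
move=> aH H0; apply: (@mul_adjmx_eq0 _ _ _ D).
by rewrite a_herm// formE// H0 mulr0 rmorph0.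
Qed.

Lemma form_ext H H' : a H -> a H' -> (forall H'', a H'' -> form H H'' = form H' H'') ->
  H = H'.
Proof.
move=> aH aH' E; apply/eqP; rewrite -subr_eq0; apply/eqP/form_def.
  exact: aB.
have := E _ (aB aH aH'); have := formDl (H - H') H' (H - H').
by rewrite subrK => ->; lra.
Qed.

Lemma form0l H : form 0 H = 0.
Proof. by have := formDl 0 0 H; rewrite addr0; lra. Qed.

Lemma formNl H H' : form (- H) H' = - form H H'.
Proof. by have := formDl H (- H) H'; rewrite subrr form0l; lra. Qed.

Definition is_coroot e v l :=
  [/\ weight_vector v l, a e, e *m e *m e = e, l e = 1
    & forall H, a H -> form e H = l H].

Lemma coroot_exists v l : weight_vector v l -> (exists2 H, a H & l H != 0) ->
  exists e, is_coroot e v l.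
Proof.
move=> vl [H1 aH1 lH1]; have ae := a_coroot vl.
exists (coroot v); split => //.
- exact: (coroot_cube vl aH1 lH1).
- exact: (weight_coroot1 vl aH1 lH1).
- move=> H aH; have := tr_coroot vl aH.
  by rewrite formE// formC => /fmorph_inj; lra.
Qed.

Lemma cube_weight e w l : a e -> e *m e *m e = e -> weight_vector w l ->
  [\/ l e = 0, l e = 1 | l e = -1].
Proof.
move=> ae e3 [w0 wl].
have : e *m e *m e *m w = e *m w by rewrite e3.
rewrite -!mulmxA wl// -!scalemxAr wl// -!scalemxAr wl// !scalerA -!rmorphM.
move/eqP; rewrite -subr_eq0 -scalerBl scaler_eq0 (negPf w0) orbF -rmorphB fmorph_eq0.
have -> : l e * l e * l e - l e = l e * ((l e - 1) * (l e + 1)) by ring.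
rewrite !mulf_eq0 subr_eq0 addr_eq0 => /or3P[] /eqP ->.
- by constructor 1.
- by constructor 2.
- by constructor 3.
Qed.

(** The vectors e_i and - e_i, which represent the nonzero weights; they play the role of [U] in the
    study of the fork. *)
Definition coroots : set 'M[F]_n := [set e | exists v l, is_coroot e v l].

Lemma coroots_a : coroots `<=` a. Proof. by move=> e [v [l []]]. Qed.

Lemma corootsN e : coroots e -> coroots (- e).
Proof.
move=> [v [l [vl ae e3 le ef]]]; exists (tau v), (fun H => - l H); split.
- exact: weight_vector_tau.
- exact: aN.
- by rewrite !(mulmxN, mulNmx) opprK e3.
- have := ef _ (aN ae); rewrite formC formNl ef// le => <-.
  by rewrite opprK.
- by move=> H aH; rewrite formNl ef.
Qed.

Lemma coroots1 e : coroots e -> form e e = 1.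
Proof. by move=> [v [l [vl ae e3 le ef]]]; rewrite ef. Qed.

Lemma coroots01 e e' : coroots e -> coroots e' ->
  [\/ form e e' = 0, form e e' = 1 | form e e' = -1].
Proof.
move=> [v [l [vl _ _ _ ef]]] [_ [_ [_ ae' e3 _ _]]].
by rewrite ef//; exact: cube_weight vl.
Qed.

Lemma weight_coroot v l : weight_vector v l ->
  exists e, [/\ a e, forall H, a H -> form e H = l H & e = 0 \/ coroots e].
Proof.
move=> vl; have [l0|nl] := pselect (exists2 H, a H & l H != 0).
  have [e ce] := coroot_exists vl l0; have [_ ae _ _ ef] := ce.
  by exists e; split => //; right; exists v, l.
exists 0; split; [exact: a0| |by left] => H aH; rewrite form0l.
by apply/esym/eqP/negP => /negP lH; apply: nl; exists H.
Qed.

Local Notation orthogonal_sum := (orthogonal_sum form coroots).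

(** A difference e - e' of vectors that are 0 or units: one of them is 0, they are orthogonal, or
    they are opposite. The first and third alternatives are the short roots of type B and the long
    roots of type C. *)
Lemma root_type d : (exists X beta, [/\ X != 0,
    forall H, a H -> lie_bracket H X = iota (beta H) *: X &
    forall H, a H -> form d H = beta H]) -> a d -> d != 0 ->
  [\/ coroots d, orthogonal_sum d | exists2 x, coroots x & d = x + x].
Proof.
move=> [X [beta [X0 XH db]]] ad d0.
have [v [l [w [l' [vl wl' bE]]]]] := root_weights X0 XH.
have [e [ae ef e_]] := weight_coroot vl.
have [e' [ae' e'f e'_]] := weight_coroot wl'.
have dE : d = e - e'.
  apply: form_ext => //; first exact: aB.
  by move=> H aH; rewrite db// bE// formDl formNl ef// e'f.
have unit := unit_eq formDl formC aD form_def coroots_a corootsN coroots1.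
case: e_ => [e0|ce]; case: e'_ => [e'0|ce'].
- by move/eqP: d0; rewrite dE e0 e'0 subr0.
- by constructor 1; rewrite dE e0 sub0r; exact: corootsN.
- by constructor 1; rewrite dE e'0 subr0.
- have [ee'|ee'|ee'] := coroots01 ce ce'.
  + constructor 2; exists e, (- e'); split => //; first exact: corootsN.
    by rewrite formC formNl formC ee' oppr0.
  + by move/eqP: d0; rewrite dE (unit _ _ ce ce' ee') subrr.
  + constructor 3; exists e => //; rewrite dE.
    congr (_ + _); apply/esym/unit; [done|exact: corootsN|].
    by rewrite formC formNl formC ee' opprK.
Qed.

Lemma formZl t H H' : form (iota t *: H) H' = t * form H H'.
Proof.
rewrite /form -scalemxAl linearZ/= rmorphM toC_iota mulrA; congr (_ / _).
by move: (toC D _) => [p q]/=; rewrite mul0r subr0.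
Qed.

(** On an empty set [get] returns the zero matrix, so a nonzero inner product certifies that a dual
    vector exists. *)
Lemma dual_vectorP al : inner_dual iota a al al != 0 ->
  a (dual_vector iota a al) /\
  forall H, a H -> \tr (dual_vector iota a al *m H) = iota (al H).
Proof.
rewrite /inner_dual /dual_vector => nz.
set S := [set h | _] in nz *.
have [[h Sh]|nS] := pselect (exists h, S h); first by have := getPex (ex_intro _ h Sh).
move: nz; rewrite getPN => [|h Sh]; last by apply: nS; exists h.
have -> : (point : 'M[F]_n) = 0 by apply/matrixP => i j; rewrite !mxE.
by rewrite mul0mx linear0 eqxx.
Qed.

(** * Simple roots and the Dynkin diagram *)

Section Diagram.
Context (r : nat) (alpha : nat -> 'M[F]_n -> R).
Hypothesis diagram : D_diagram iota a r alpha.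
Local Notation C := D_cartan_matrix.

Lemma diagram_vectors : exists d : nat -> 'M[F]_n,
  forall i, (1 <= i <= r)%N ->
    [/\ a (d i), forall H, a H -> form (d i) H = alpha i H,
        form (d i) (d i) != 0 &
        forall j, (1 <= j <= r)%N ->
          2 * form (d i) (d j) = (C i j)%:~R * form (d j) (d j)].
Proof.
pose h i := dual_vector iota a (alpha i).
have hP i : (1 <= i <= r)%N ->
    a (h i) /\ forall H, a H -> \tr (h i *m H) = iota (alpha i H).
  (* Division by 0 gives 0, whereas the diagonal Cartan integer is 2. *)
  move=> ir; apply: dual_vectorP; apply/eqP => i0.
  have := diagram ir ir; rewrite /cartan_integer i0 invr0 mulr0 /C eqxx.
  by move/eqP; rewrite eq_sym pnatr_eq0.
have ah i : (1 <= i <= r)%N -> a (h i) by move=> /hP[].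
have hh i j : (1 <= i <= r)%N -> (1 <= j <= r)%N ->
    inner_dual iota a (alpha i) (alpha j) = iota (2 * form (h i) (h j)).
  by move=> ir jr; rewrite -formE//; exact: ah.
have dd i j : form (h i + h i) (h j + h j) = 4 * form (h i) (h j).
  by rewrite formDl !(formC (h i)) formDl; ring.
(* The doubling compensates for the factor 1/2 in [form]. *)
exists (fun i => h i + h i) => i ir; have [ahi ha] := hP _ ir.
have nz j : (1 <= j <= r)%N -> form (h j) (h j) != 0.
  move=> jr; apply/eqP => i0; have := diagram jr jr.
  rewrite /cartan_integer hh// i0 mulr0 rmorph0 invr0 mulr0 /C eqxx.
  by move/eqP; rewrite eq_sym pnatr_eq0.
split; first exact: aD.
- move=> H aH; have := ha _ aH; rewrite formE// => /fmorph_inj <-.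
  by rewrite formDl; ring.
- by rewrite dd mulf_neq0// nz.
- move=> j jr; rewrite !dd.
  have := diagram ir jr; rewrite /cartan_integer !hh//.
  have nzj : form (h j) (h j) != 0 by exact: nz.
  rewrite -(rmorph_nat iota 2) -rmorphM -fmorph_div -(rmorph_int iota).
  move/fmorph_inj => <-; rewrite /C; field.
  by rewrite nzj.
Qed.

Context (d : nat -> 'M[F]_n).
Hypotheses (r4 : (4 <= r)%N) (ad : forall i, (1 <= i <= r)%N -> a (d i))
  (d_alpha : forall i, (1 <= i <= r)%N -> forall H, a H -> form (d i) H = alpha i H)
  (d_neq0 : forall i, (1 <= i <= r)%N -> form (d i) (d i) != 0)
  (d_cartan : forall i j, (1 <= i <= r)%N -> (1 <= j <= r)%N ->
     2 * form (d i) (d j) = (C i j)%:~R * form (d j) (d j)).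

Lemma edge_form i j : (1 <= i <= r)%N -> (1 <= j <= r)%N -> i != j -> D_edge i j ->
  form (d i) (d i) = form (d j) (d j) /\ 2 * form (d i) (d j) = - form (d i) (d i).
Proof.
move=> ir jr ij eij; have := d_cartan ir jr; have := d_cartan jr ir.
have eji : D_edge j i by rewrite /D_edge minnC maxnC.
rewrite /C eq_sym (negPf ij) eij eji (formC (d j)) !mulN1r => -> /oppr_inj ->.
by [].
Qed.

Lemma nonedge_form i j : (1 <= i <= r)%N -> (1 <= j <= r)%N -> i != j ->
  ~~ D_edge i j -> form (d i) (d j) = 0.
Proof.
move=> ir jr ij eij; have := d_cartan ir jr.
by rewrite /C (negPf ij) (negPf eij) mul0r; lra.
Qed.

Definition is_root (al : 'M[F]_n -> R) := exists2 X, X != 0 &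
  forall H, a H -> lie_bracket H X = iota (al H) *: X.

(** Linked simple roots have the same squared length: 1, 2 or 4, according to [root_type]. Their
    product is minus half of it; but two units never have product -1/2, and two doubled units have
    product 0, 4 or -4, never -2. *)
Lemma linked_orthogonal_sum i j : (1 <= i <= r)%N -> (1 <= j <= r)%N -> i != j ->
  D_edge i j -> is_root (alpha i) -> is_root (alpha j) -> orthogonal_sum (d i).
Proof.
move=> ir jr ij eij [X X0 XH] [Y Y0 YH].
have [eii e2ij] := edge_form ir jr ij eij.
have nz i' : (1 <= i' <= r)%N -> d i' != 0.
  by move=> ir'; apply: contraNneq (d_neq0 ir') => ->; rewrite form0l.
have ti : [\/ coroots (d i), orthogonal_sum (d i) | exists2 x, coroots x & d i = x + x].
  apply: root_type; [|exact: ad|exact: nz].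
  by exists X, (alpha i); split => //; exact: d_alpha.
have tj : [\/ coroots (d j), orthogonal_sum (d j) | exists2 x, coroots x & d j = x + x].
  apply: root_type; [|exact: ad|exact: nz].
  by exists Y, (alpha j); split => //; exact: d_alpha.
have v2 k : orthogonal_sum (d k) -> form (d k) (d k) = 2.
  move=> [x [y [Ux Uy xy ->]]]; rewrite formDl !(formC _ (x + y)) !formDl.
  by rewrite !coroots1// (formC y) xy; ring.
have v4 (x : 'M[F]_n) k : coroots x -> d k = x + x -> form (d k) (d k) = 4.
  by move=> Ux ->; rewrite formDl !(formC x) formDl coroots1//; ring.
case: ti => [ci|//|[x cx dx]].
- exfalso; rewrite coroots1// in eii e2ij.
  case: tj => [cj|/v2|[y cy dy]]; last by have := v4 _ _ cy dy; lra.
    by have [] := coroots01 ci cj; lra.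
  lra.
- exfalso; rewrite (v4 _ _ cx dx) in eii e2ij.
  case: tj => [cj|/v2|[y cy dy]]; first by have := coroots1 cj; lra.
    lra.
  move: e2ij; rewrite dx dy formDl !(formC x) formDl.
  by have [] := coroots01 cy cx; lra.
Qed.

Lemma diagram_weight : (5 <= r)%N ->
  (forall i, (1 <= i <= r)%N -> is_root (alpha i)) ->
  exists v l, weight_vector v l /\
    forall H, a H -> alpha 1%N H - alpha 2%N H = 2 * l H.
Proof.
move=> r5 rt.
have r1 : (1 <= 1 <= r)%N by rewrite /= (leq_trans _ r4).
have r2 : (1 <= 2 <= r)%N by rewrite /= (leq_trans _ r4).
have r3 : (1 <= 3 <= r)%N by rewrite /= (leq_trans _ r4).
have r4' : (1 <= 4 <= r)%N by rewrite /= (leq_trans _ r5).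
have r5' : (1 <= 5 <= r)%N by rewrite /= (leq_trans _ r5).
have [e13 f13] := edge_form r1 r3 isT isT.
have [e23 f23] := edge_form r2 r3 isT isT.
have [e43 f43] := edge_form r4' r3 isT isT.
have [e54 f54] := edge_form r5' r4' isT isT.
have S1 := linked_orthogonal_sum r1 r3 isT isT (rt _ r1) (rt _ r3).
have S2 := linked_orthogonal_sum r2 r3 isT isT (rt _ r2) (rt _ r3).
have S3 := linked_orthogonal_sum r3 r1 isT isT (rt _ r3) (rt _ r1).
have S4 := linked_orthogonal_sum r4' r3 isT isT (rt _ r4') (rt _ r3).
have S5 := linked_orthogonal_sum r5' r4' isT isT (rt _ r5') (rt _ r4').
have f1 : form (d 1) (d 1) = 2.
  have [x [y [Ux Uy xy ->]]] := S1.
  rewrite formDl !(formC _ (x + y)) !formDl.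
  by rewrite !coroots1// (formC y) xy; ring.
have [|||||||||x Ux xE] := fork_difference formDl formC aD form_def coroots_a corootsN
  coroots1 coroots01 S1 S2 S3 S4 S5; try lra; try exact: nonedge_form.
have [v [l [vl ax _ _ xf]]] := Ux.
exists v, l; split => // H aH.
rewrite -!d_alpha// -formNl -formDl xE formDl xf//.
by ring.
Qed.

(** The reflection changes alpha_i(H) by - 2 l(H) alpha_i(E_l), and 2 l(H) = alpha_1(H) -
    alpha_2(H). It remains to see that alpha_i(E_l) = l(d_i) is 1, -1, 0 for i = 1, i = 2, i >= 3;
    the last because nodes 1 and 2 have the same neighbour. *)
Lemma reflection_swap v l : weight_vector v l ->
  (forall H, a H -> alpha 1%N H - alpha 2%N H = 2 * l H) ->
  (exists2 H, a H & l H != 0) /\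
  forall H, a H -> forall i, (1 <= i <= r)%N ->
    alpha i (weight_reflection v *m H *m weight_reflection v) =
    alpha (diagram_swap i) H.
Proof.
move=> vl lE.
have r1 : (1 <= 1 <= r)%N by rewrite /= (leq_trans _ r4).
have r2 : (1 <= 2 <= r)%N by rewrite /= (leq_trans _ r4).
have r3 : (1 <= 3 <= r)%N by rewrite /= (leq_trans _ r4).
have [e13 _] := edge_form r1 r3 isT isT.
have [e23 _] := edge_form r2 r3 isT isT.
have e12 := nonedge_form r1 r2 isT isT.
have ld i : (1 <= i <= r)%N -> 2 * l (d i) = form (d 1) (d i) - form (d 2) (d i).
  by move=> ir; rewrite -lE ?d_alpha//; exact: ad.
have l1 := ld _ r1; have l2 := ld _ r2; rewrite (formC (d 2) (d 1)) e12 in l1.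
rewrite e12 in l2.
have lnz : l (d 1) != 0.
  by apply/eqP => l10; have := d_neq0 r1 => /eqP; lra.
split; first by exists (d 1) => //; exact: ad.
have ae := a_coroot vl.
have ef H : a H -> form (coroot v) H = l H.
  by move=> aH; have := tr_coroot vl aH; rewrite formE// formC => /fmorph_inj; lra.
have le := weight_coroot1 vl (ad r1) lnz.
(* From 2 = 2 l(E_l) = l(d_1) - l(d_2), where the right-hand side is the common squared length of
   d_1 and d_2. *)
have q2 : form (d 1) (d 1) = 2.
  have := lE _ ae; rewrite le -!d_alpha// !(formC _ (coroot v)).
  by rewrite (ef _ (ad r1)) (ef _ (ad r2)); lra.
move=> H aH i ir.
have aR : a (weight_reflection v *m H *m weight_reflection v).
  rewrite (weight_reflection_a vl (ad r1) lnz aH) addrC -scaleNr -rmorphN.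
  exact: aDZ.
rewrite -d_alpha// (weight_reflection_a vl (ad r1) lnz aH) formC formDl formNl formZl.
rewrite (ef _ (ad ir)) formC d_alpha//.
have hl := lE _ aH; rewrite /diagram_swap.
have [i1|ni1] := eqVneq i 1%N; first by rewrite i1 (_ : l (d 1) = 1); lra.
have [i2|ni2] := eqVneq i 2%N.
  by rewrite i2 (_ : l (d 2) = -1); lra.
suff -> : l (d i) = 0 by ring.
have := ld _ ir; have := d_cartan r1 ir; have := d_cartan r2 ir.
have -> : C 1 i = C 2 i.
  rewrite /C /D_edge; case: i ir ni1 ni2 {ld} => [|[|[|[|i]]]]//.
by lra.
Qed.

End Diagram.

(** * Roots built from weights, and separation of points *)

Lemma weight_dual v l : weight_vector v l -> dual iota a l.
Proof.
move=> [v0 vl] t X Y aX aY; apply: (fmorph_inj iota); apply/eqP.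
rewrite -subr_eq0; have := vl _ (aDZ t aX aY).
rewrite mulmxDl -scalemxAl !vl// => /eqP; rewrite scalerA -scalerDl.
rewrite -rmorphM -rmorphD eq_sym -subr_eq0 -scalerBl scaler_eq0 (negPf v0) orbF.
by [].
Qed.

(** The bivector v ∧ w as a J-skew endomorphism. It is the converse of [root_weights]: it produces a
    root vector from two weight vectors. *)
Definition wedge v w : 'M[F]_n := (v *m w^T - w *m v^T) *m J.

Lemma wedge_skew v w : skew_J J (wedge v w).
Proof.
rewrite /skew_J /wedge trmx_mul J_tr linearB/= !trmx_mul !trmxK -mulmxA -mulmxDr.
by rewrite -mulmxDl addrA subrK subrr mul0mx mulmx0.
Qed.

Lemma wedge_neq0 v w : v != 0 -> w != 0 -> ip v w = 0 -> wedge v w != 0.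
Proof.
(* On tau v the matrix takes the value [ip v w] v - [ip v v] w, whose first term vanishes. *)
move=> v0 w0 vw; apply/eqP => /(congr1 (mulmx^~ (tau v))).
rewrite mul0mx /wedge /tau -mulmxA (mulmxA J) JJ mul1mx mulmxBl -!mulmxA.
have ipT (y : 'cV[F]_n) : y^T *m conjmx v = (ip v y)%:M.
  rewrite -(trmxK (y^T *m _)) trmx_mul trmxK -adjmxE ipE.
  by rewrite tr_scalar_mx.
rewrite !ipT vw !mul_mx_scalar scale0r sub0r => /eqP.
rewrite oppr_eq0 scaler_eq0 (negPf w0) orbF => /eqP /ip_eq0 /eqP.
by rewrite (negPf v0).
Qed.

Lemma wedge_root v l w l' H : weight_vector v l -> weight_vector w l' -> a H ->
  lie_bracket H (wedge v w) = iota (l H + l' H) *: wedge v w.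
Proof.
move=> [_ vl] [_ wl] aH.
have JH : J *m H = - (H^T *m J).
  by apply/eqP; rewrite -addr_eq0 addrC; apply/eqP; exact: a_skew.
have vH : v^T *m H^T = iota (l H) *: v^T by rewrite -trmx_mul vl// linearZ.
have wH : w^T *m H^T = iota (l' H) *: w^T by rewrite -trmx_mul wl// linearZ.
rewrite /lie_bracket /wedge -[_ *m J *m H]mulmxA JH mulmxN opprK !mulmxA -mulmxDl.
rewrite mulmxBr !mulmxBl !mulmxA vl// wl// -!scalemxAl -!(mulmxA _ _ H^T) vH wH.
rewrite -!scalemxAr -mulmxBl !scalemxAl; congr (_ *m _); rewrite -!scalemxAl.
move: (v *m w^T) (w *m v^T) => p q; rewrite rmorphD.
by apply/matrixP => i j; rewrite !mxE; ring.
Qed.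

(** With e = E_l, 1 - e e is the projection onto the orthogonal complement of v and tau v. It
    commutes with [a], and it is nonzero because e has rank at most 2 < n. *)
Lemma coroot_projection v l : weight_vector v l -> (exists2 H, a H & l H != 0) ->
  (2 < n)%N ->
  exists w l', [/\ weight_vector w l', ip v w = 0 & ip (tau v) w = 0].
Proof.
move=> vl [H1 aH1 lH1] n2; pose e := coroot v.
have eH H : a H -> e *m H = H *m e.
  by move=> aH; apply: a_comm => //; exact: a_coroot vl.
pose Q : 'M[F]_n := 1%:M - e *m e.
have rke : (\rank e <= 2)%N.
  rewrite /e /coroot; apply: leq_trans (mxrank_scale _ _) _.
  apply: leq_trans (mxrank_add _ _) _; rewrite mxrank_opp.
  by rewrite -(addn1 1) leq_add// mulmx_max_rank.
have Q0 : Q != 0.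
  apply/eqP => /eqP; rewrite subr_eq0 => /eqP Q0.
  have := mxrankM_maxl e e; rewrite -Q0 mxrank1 => ne.
  by have := leq_trans n2 (leq_trans ne rke); rewrite ltnn.
have [H aH|w [l' [wl' /submxP[z wz]]]] := weight_vector_in Q0.
  have -> : Q *m H = H *m Q.
    by rewrite mulmxBl mulmxBr mul1mx mulmx1 -mulmxA (eH H)// !mulmxA (eH H).
  exact: submxMl.
have ew : e *m w = 0.
  rewrite -[LHS](adjmxK D) adjmxM wz (coroot_herm v) -mulmxA mulmxBl mul1mx.
  rewrite (coroot_cube vl aH1 lH1) subrr mulmx0.
  by apply/eqP; rewrite adjmx_eq0.
exists w, l'; split => //.
- by rewrite -(coroot_v vl aH1 lH1) ip_mull coroot_herm ew ip0r.
- apply/eqP; rewrite -oppr_eq0 -ipNl -(coroot_tau vl aH1 lH1) ip_mull coroot_herm.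
  by rewrite ew ip0r.
Qed.

Context (g : set 'M[F]_n) (gP : forall X, g X <-> skew_J J X).
Context (P : set ('M[F]_n -> R)) (Ppos : positive_system iota g a P).

(** Unless l + l' vanishes on [a], [wedge v w] makes it a root. Then it is positive, or else its
    negative is, which is a root by way of tau v and tau w. *)
Lemma weight_sum_zero v l w l' H : weight_vector v l -> weight_vector w l' ->
  ip v w = 0 -> a H -> (forall be, P be -> be H = 0) -> l H + l' H = 0.
Proof.
move=> vl wl vw aH PH; have [H0 [aH0 H0reg PE]] := Ppos.
have [b0|nb0] := pselect (eq_dual a (fun H => l H + l' H) (fun=> 0)); first exact: b0.
have root x (m : 'M[F]_n -> R) y m' : weight_vector x m -> weight_vector y m' ->
    ip x y = 0 -> ~ eq_dual a (fun H => m H + m' H) (fun=> 0) ->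
    restricted_roots iota g a (fun H => m H + m' H).
  move=> xm ym xy mm; split => //.
    move=> t X Y aX aY; rewrite (weight_dual xm)// (weight_dual ym)//; ring.
  exists (wedge x y); last by apply: wedge_neq0 => //; [case: xm|case: ym].
  split; first by apply/gP; exact: wedge_skew.
  by move=> H' aH'; exact: wedge_root.
have rt := root _ _ _ _ vl wl vw nb0.
have := H0reg _ rt; rewrite neq_lt => /orP[neg|pos]; last first.
  by apply: (PH (fun H => l H + l' H)); rewrite PE.
have rt' : restricted_roots iota g a (fun H => - l H + - l' H).
  apply: (root _ _ _ _ (weight_vector_tau vl) (weight_vector_tau wl)).
    by rewrite ip_tau -(ip_cj D) vw rmorph0.
  move=> z; apply: nb0 => H' aH'; have := z _ aH' => /= zz.
  by apply/eqP; rewrite -oppr_eq0 opprD zz.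
have Pb : P (fun H => - l H + - l' H).
  by rewrite PE; split => //=; rewrite -opprD oppr_gt0.
by have /eqP := PH _ Pb; rewrite /= -opprD oppr_eq0 => /eqP.
Qed.

(** Otherwise some weight l has l(H) nonzero. For a weight vector w, of weight l', orthogonal to v
    and tau v, both l + l' and l - l' vanish at [H], hence so does l. *)
Lemma roots_separate H : (2 < n)%N -> a H -> (forall be, P be -> be H = 0) -> H = 0.
Proof.
move=> n2 aH PH; apply/eqP; apply: contrapT => /negP H0.
have [H' aH'|v [l [vl /submxP[z vz]]]] := weight_vector_in H0.
  by rewrite (a_comm aH aH') submxMl.
have lH : l H != 0.
  apply/eqP => l0; have := vl.2 _ aH; rewrite l0 rmorph0 scale0r => Hv.
  have := vl.1 => /eqP; apply; apply: (@adj_self_eq0 _ _ _ D).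
  by rewrite vz -mulmxA Hv mulmx0.
have [w [l' [wl vw tvw]]] := coroot_projection vl (ex_intro2 _ _ H aH lH) n2.
have e1 := weight_sum_zero vl wl vw aH PH.
have vtw : ip v (tau w) = 0.
  by rewrite -{1}(tauK v) ip_tau -(ip_cj D) tvw rmorph0.
have e2 := weight_sum_zero vl (weight_vector_tau wl) vtw aH PH.
by move/eqP: lH; apply; lra.
Qed.

(** * Positive roots and the diagram involution *)

Context (r : nat) (alpha : nat -> 'M[F]_n -> R).
Hypothesis numbering : simple_root_numbering a P r alpha.

(** Takes the place of the expansion of a positive root into simple roots; it is applied with [S]
    the zero or the positive reals. *)
Lemma positive_root_ind (S : R -> Prop) H : (forall x y : R, S x -> S y -> S (x + y)) ->
  a H -> (forall i, (1 <= i <= r)%N -> S (alpha i H)) ->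
  forall be, P be -> S (be H).
Proof.
move=> SD aH Sa; have [H0 [aH0 H0reg PE]] := Ppos.
have [_ _ simple] := numbering.
pose adH := lin_mulmx H0 - lin_mulmxr H0.
have eig be : P be -> root (char_poly adH) (iota (be H0)).
  rewrite PE => -[[_ _ [X [gX Xb] X0]] _].
  rewrite -eigenvalue_root_char; apply/eigenvalueP; exists (mxvec X).
    rewrite mulmxBr !mul_vec_lin/= -linearB/= -[_ - _]/(lie_bracket H0 X) Xb//.
    by rewrite linearZ.
  by apply: contraNneq X0 => /(congr1 vec_mx); rewrite mxvecK linear0 => ->.
(* A decomposition into two positive roots descends strictly through the finitely
   many eigenvalues of [ad H0], so it terminates. *)
suff ind k : forall s : seq R, uniq s ->
    (forall x : R, x \in s -> root (char_poly adH) (iota x)) ->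
    (size (char_poly adH) <= size s + k)%N ->
    forall be, P be -> (forall x : R, x \in s -> be H0 < x) -> S (be H).
  by move=> be Pbe; apply: (ind (size (char_poly adH)) [::]).
elim: k => [|k IH] s us sroot sk be Pbe bes; last first.
  have [[i ir bi]|nsimple] := pselect
      (exists2 i, (1 <= i <= r)%N & eq_dual a be (alpha i)).
    by rewrite bi//; exact: Sa.
  have [ga [de [Pga Pde bgd]]] : exists ga de,
      [/\ P ga, P de & eq_dual a be (fun H => ga H + de H)].
    by apply: contrapT => nd; apply/nsimple/simple.
  have ub : uniq (be H0 :: s).
    by rewrite /= us andbT; apply/negP => /bes; rewrite ltxx.
  have rb (x : R) : x \in be H0 :: s -> root (char_poly adH) (iota x).
    by rewrite in_cons => /orP[/eqP ->|/sroot//]; exact: eig.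
  have ga0 : 0 < ga H0 by move: Pga; rewrite PE => -[].
  have de0 : 0 < de H0 by move: Pde; rewrite PE => -[].
  have bgd0 := bgd _ aH0.
  have step be' : be' H0 < be H0 -> P be' -> S (be' H).
    move=> lt Pbe'; apply: (IH _ ub rb) => //; first by rewrite addSnnS.
    move=> x; rewrite in_cons => /orP[/eqP -> //|/bes]; exact: lt_trans.
  rewrite bgd//; apply: SD; apply: step => //; rewrite bgd0; lra.
(* Here [s] would hold more distinct roots than the degree of the polynomial allows. *)
have p0 : char_poly adH != 0 by rewrite monic_neq0// char_poly_monic.
have := max_poly_roots p0 (_ : all (root (char_poly adH)) (map iota s)).
rewrite map_inj_uniq ?us; last exact: fmorph_inj.
rewrite size_map ltnNge -(addn0 (size s)) sk.
move=> /(_ _ isT) h; suff : false by [].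
apply: h; apply/allP => _ /mapP[x xs ->]; exact: sroot.
Qed.

Lemma diagram_reflection : (2 < n)%N -> (4 <= r)%N -> D_diagram iota a r alpha ->
  (r = 4%N -> defining_weight iota a (fun H => (alpha 1%N H - alpha 2%N H) / 2)) ->
  exists w : 'M[F]_n, [/\ w *m w = 1%:M, adjmx w = w, J *m conjmx w *m J = w,
    forall H, a H -> diagram_involution a r alpha H = w *m H *m w &
    forall X, iwasawa_n iota g a P X -> iwasawa_n iota g a P (w *m X *m w)].
Proof.
move=> n2 r4 diagram fork4.
have [H0 [aH0 H0reg PE]] := Ppos.
have [alphaP _ _] := numbering.
have Palpha i : (1 <= i <= r)%N -> P (alpha i) by move=> /alphaP[].
have roots i : (1 <= i <= r)%N -> restricted_roots iota g a (alpha i).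
  by move=> /Palpha; rewrite PE => -[].
have [d dP] := diagram_vectors diagram.
have ad i : (1 <= i <= r)%N -> a (d i) by move=> /dP[].
have d_alpha i : (1 <= i <= r)%N -> forall H, a H -> form (d i) H = alpha i H.
  by move=> /dP[].
have d_neq0 i : (1 <= i <= r)%N -> form (d i) (d i) != 0 by move=> /dP[].
have d_cartan i j : (1 <= i <= r)%N -> (1 <= j <= r)%N ->
    2 * form (d i) (d j) = (D_cartan_matrix i j)%:~R * form (d j) (d j).
  by move=> /dP[_ _ _]; apply.
have [v [l [vl lE]]] : exists v l, weight_vector v l /\
    forall H, a H -> alpha 1%N H - alpha 2%N H = 2 * l H.
  have := r4; rewrite leq_eqVlt => /orP[/eqP r_4|r5].
    have [v v0 vH] := fork4 (esym r_4).
    exists v, (fun H => (alpha 1%N H - alpha 2%N H) / 2); split; first by split.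
    by move=> H aH; field.
  apply: (diagram_weight r4 ad d_alpha d_neq0 d_cartan) => // i ir.
  by have [_ _ [X [_ XH] X0]] := roots _ ir; exists X.
have [[H1 aH1 lH1] swap] := reflection_swap r4 ad d_alpha d_neq0 d_cartan vl lE.
set w := weight_reflection v in swap.
have ww : w *m w = 1%:M := weight_reflectionK vl aH1 lH1.
have wh : adjmx w = w := weight_reflection_herm v.
have wJ : J *m conjmx w *m J = w := weight_reflection_conj v.
have aw H : a H -> a (w *m H *m w).
  move=> aH; rewrite (weight_reflection_a vl aH1 lH1 aH) addrC -scaleNr -rmorphN.
  exact: aDZ (a_coroot vl) aH.
clearbody w.
have wwK X : w *m (w *m X *m w) *m w = X.
  by rewrite !mulmxA ww mul1mx -mulmxA ww mulmx1.
have bracket H X : lie_bracket H (w *m X *m w) = w *m lie_bracket (w *m H *m w) X *m w.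
  rewrite /lie_bracket mulmxBr mulmxBl -!mulmxA ww mulmx1 !mulmxA.
  by rewrite ww mul1mx.
have wTJw := form_preserved JJ ww wh wJ.
have dualP i : (1 <= i <= r)%N -> dual iota a (alpha i) by move=> /roots[].
have dualB be H H' : dual iota a be -> a H -> a H' -> be (H - H') = be H - be H'.
  move=> bd aH aH'; rewrite addrC -scaleN1r -(rmorph1 iota) -rmorphN bd//.
  by rewrite mulN1r addrC.
exists w; split => //.
- move=> H aH; rewrite /diagram_involution.
  set Sg := [set H' | _].
  have Sw : Sg (w *m H *m w) by split; [exact: aw | exact: swap].
  have [aG Gi] : Sg (get Sg) by apply: getPex; exists (w *m H *m w).
  (* Uniqueness of sigma H: the difference of two solutions is killed by the simple roots, hence by
     the positive ones, hence is 0. *)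
  apply/eqP; rewrite -subr_eq0; apply/eqP; apply: roots_separate => //.
    by apply: aB => //; exact: aw.
  apply: (@positive_root_ind (fun t : R => t = 0) (get Sg - w *m H *m w)) =>
    [x y -> ->||i ir].
  + exact: addr0.
  + by apply: aB => //; exact: aw.
  + by rewrite dualB//; [rewrite Gi// swap// subrr|exact: dualP|exact: aw].
- have Pw be : P be -> P (fun H => be (w *m H *m w)).
    move=> Pbe; have := Pbe; rewrite {1}PE => -[[bd b0 [X [gX XH] X0]] bpos].
    rewrite PE; split; last first.
      (* w H0 w lies in the same Weyl chamber as [H0]: the simple roots take there the values of the
         swapped simple roots at [H0]. *)
      apply: (@positive_root_ind (fun t : R => 0 < t) (w *m H0 *m w)) Pbe =>
        [x y||i ir].
      + exact: addr_gt0.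
      + exact: aw.
      + rewrite swap//; have ir' : (1 <= diagram_swap i <= r)%N.
          by rewrite /diagram_swap; case: eqP => _; [|case: eqP => _];
            rewrite // (leq_trans _ r4).
        by have := Palpha _ ir'; rewrite PE => -[].
    split.
    + move=> t X' Y' aX aY; rewrite mulmxDr mulmxDl -scalemxAr -scalemxAl.
      by rewrite bd//; exact: aw.
    + move=> bw; apply: b0 => H aH; rewrite -(wwK H); apply: bw; exact: aw.
    + exists (w *m X *m w); last first.
        by apply: contraNneq X0 => X0; rewrite -(wwK X) X0 mulmx0 mul0mx.
      split; first by apply/gP; apply: (skew_J_conj ww wTJw); exact/gP.
      by move=> H aH; rewrite bracket XH -?scalemxAr -?scalemxAl//; exact: aw.
  move=> X XN V Vsub VP.
  pose V' : set 'M[F]_n := [set Y | V (w *m Y *m w)].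
  apply: (XN V').
    split; first by rewrite /V' /= mulmx0 mul0mx; case: Vsub.
    move=> t Y Z VY VZ; rewrite /V' /= mulmxDr mulmxDl -scalemxAr -scalemxAl.
    by case: Vsub => _; apply.
  move=> Y [be Pbe [gY YH]]; apply: VP; exists (fun H => be (w *m H *m w)).
    exact: Pw.
  split; first by apply/gP; apply: (skew_J_conj ww wTJw); exact/gP.
  by move=> H aH; rewrite bracket YH -?scalemxAr -?scalemxAl//; exact: aw.
Qed.

End WeightVectors.

(** * Conjugation by the reflection as an automorphism of the group *)

Section DiagramInvolution.
Context (R : realType) (F : numFieldType) (iota : {rmorphism R -> F}).
Context (D : conj_scalars iota) (n : nat) (J : 'M[F]_n).
Local Notation conjmx := (conjmx D).
Local Notation adjmx := (adjmx D).
Hypotheses (J_tr : J^T = J) (JJ : J *m J = 1%:M) (J_conj : conjmx J = J).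

Definition conj_by (w A : 'M[F]_n) : 'M[F]_n := w *m A *m w.

Lemma conj_byK w : w *m w = 1%:M -> involutive (conj_by w).
Proof. by move=> ww A; rewrite /conj_by !mulmxA ww mul1mx -mulmxA ww mulmx1. Qed.

Lemma conj_byM w A B : w *m w = 1%:M ->
  conj_by w (A *m B) = conj_by w A *m conj_by w B.
Proof. by move=> ww; rewrite /conj_by !mulmxA -(mulmxA _ w w) ww mulmx1. Qed.

Lemma conj_by1 w : w *m w = 1%:M -> conj_by w 1%:M = 1%:M.
Proof. by move=> ww; rewrite /conj_by mulmx1. Qed.

Lemma continuous_conj_by w : continuous (conj_by w).
Proof.
move=> A; have h : (w *m B *m w) @[B --> A] --> w *m A *m w.
  have fA : Filter (nbhs A) by exact: nbhs_filter.
  apply: (cvg_mulmx (FFF := fA)); last exact: cvg_cst.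
  by apply: (cvg_mulmx (FFF := fA)); [exact: cvg_cst|exact: cvg_id].
exact: h.
Qed.

Lemma conj_by_image w (S : set 'M[F]_n) : w *m w = 1%:M ->
  (forall A, S A -> S (conj_by w A)) -> conj_by w @` S = S.
Proof.
move=> ww Sw; apply/seteqP; split => [_ [A SA <-]|A SA]; first exact: Sw.
by exists (conj_by w A); [exact: Sw|rewrite conj_byK].
Qed.

Lemma conj_by_involutive_automorphism G w : w *m w = 1%:M ->
  (forall A, G A -> G (conj_by w A)) -> involutive_automorphism G (conj_by w).
Proof.
move=> ww Gw; split => // [A B _ _|A _|]; [exact: conj_byM|exact: conj_byK|].
by apply: continuous_subspaceT => A; exact: continuous_conj_by.
Qed.

Lemma analytic_subgroup_conj w V : w *m w = 1%:M ->
  (forall X, V X -> V (conj_by w X)) ->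
  conj_by w @` analytic_subgroup V = analytic_subgroup V.
Proof.
move=> ww Vw; apply: conj_by_image => // A AN G [G1 GM GV] VG.
(* The preimage under conjugation of a subgroup containing the exponentials is again such a
   subgroup. *)
pose G' : set 'M[F]_n := [set B | G (conj_by w B)].
apply: (AN G').
  split; first by rewrite /G' /= conj_by1.
    by move=> B C GB GC; rewrite /G' /= conj_byM//; exact: GM.
  move=> B GB; have [uB GB'] := GV _ GB.
  have uB' : B \in unitmx.
    by move: uB; rewrite !unitmx_mul => /andP[/andP[_ ->]].
  split => //; rewrite /G' /=.
  have -> : conj_by w (invmx B) = invmx (conj_by w B); last exact: GB'.
  apply: (can_inj (mulmxK uB)); rewrite mulVmx// -conj_byM// mulVmx//.
  exact: conj_by1.
move=> _ [X VX <-]; rewrite /G' /= /conj_by -(expmx_conj D)//.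
by apply: VG; exists (conj_by w X) => //; exact: Vw.
Qed.

Context (G : set 'M[F]_n) (theta : 'M[F]_n -> 'M[F]_n).
Hypotheses (GJ : forall A, G A -> A^T *m J *m A = J)
  (Gexp : forall X, skew_J J X -> lie_algebra iota G X)
  (Gtheta : forall A, G A -> theta A = J *m conjmx A *m J)
  (Gconj : forall w, w *m w = 1%:M -> w^T *m J *m w = J ->
     forall A, G A -> G (conj_by w A)).

Theorem diagram_involution_conj (a : set 'M[F]_n) (P : set ('M[F]_n -> R)) r
    (alpha : nat -> 'M[F]_n -> R) :
  let g := lie_algebra iota G in
  let N := analytic_subgroup (iwasawa_n iota g a P) in
  (2 < n)%N -> (4 <= r)%N ->
  maximal_abelian_in iota (cartan_s iota G theta) a ->
  positive_system iota g a P -> D_numbering iota a P r alpha ->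
  exists w, [/\ w *m w = 1%:M, adjmx w = w, J *m conjmx w *m J = w &
    [/\ involutive_automorphism G (conj_by w),
      forall H, a H ->
        differential_at1 iota (conj_by w) H (diagram_involution a r alpha H),
      forall A, G A -> conj_by w (theta A) = theta (conj_by w A)
    & conj_by w @` N = N]].
Proof.
move=> g N n2 r4 [[a_sub a_ab] a_s a_max] Ppos [numb diag fork4].
have sP X := cartan_sP JJ GJ Gexp Gtheta X.
have gP X : g X <-> skew_J J X := lie_algebraP D GJ Gexp X.
have a_skew H : a H -> skew_J J H by move=> /a_s/sP[].
have a_herm H : a H -> adjmx H = H by move=> /a_s/sP[].
have a_comm H H' : a H -> a H' -> H *m H' = H' *m H.
  by move=> aH aH'; apply/eqP; rewrite -subr_eq0; apply/eqP/(a_ab H H').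
have a_max' H : skew_J J H -> adjmx H = H ->
    (forall H', a H' -> H' *m H = H *m H') -> a H.
  move=> HJ Hh HC.
  (* Maximality among subspaces becomes a criterion for a single [H] by applying it to R H + a. *)
  pose b : set 'M[F]_n := [set X | exists t Y, a Y /\ X = iota t *: H + Y].
  have -> : a = b; last first.
    exists 1, 0; rewrite rmorph1 scale1r addr0; split => //.
    by case: a_sub.
  apply/esym/a_max.
  - split.
      split; first by exists 0, 0; rewrite rmorph0 scale0r addr0; case: a_sub.
      move=> t _ _ [x [X [aX ->]]] [y [Y [aY ->]]].
      exists (t * x + y), (iota t *: X + Y); split; first by case: a_sub => _; apply.
      rewrite scalerDr scalerA -rmorphM addrACA -scalerDl -rmorphD.
      by [].
    move=> _ _ [x [X [aX ->]]] [y [Y [aY ->]]].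
    apply/eqP; rewrite subr_eq0; apply/eqP.
    rewrite !mulmxDl !mulmxDr -!scalemxAl -!scalemxAr !scalerA (mulrC (iota y)).
    rewrite (a_comm X Y)// (HC X)// (HC Y)// -!addrA; congr (_ + _).
    by rewrite addrCA.
  - move=> _ [x [X [aX ->]]]; apply/sP; split.
      rewrite /skew_J linearD/= linearZ/= mulmxDl mulmxDr -scalemxAl -scalemxAr.
      by rewrite addrACA -scalerDr (a_skew X aX) HJ scaler0 addr0.
    by rewrite adjmxD adjmxZ cj_iota Hh a_herm.
  - by move=> X aX; exists 0, X; rewrite rmorph0 scale0r add0r.
have [w [ww wh wJ wsigma wN]] := diagram_reflection J_tr JJ J_conj a_skew a_herm
  a_comm a_sub a_max' gP Ppos numb n2 r4 diag fork4.
have Gw := Gconj ww (form_preserved JJ ww wh wJ).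
exists w; split => //; split.
- exact: conj_by_involutive_automorphism.
- by move=> H aH; rewrite wsigma//; exact: (differential_mulmx D).
- move=> A GA; rewrite !Gtheta//; last exact: Gw.
  have cw : conjmx w *m J = J *m w.
    by rewrite -{2}wJ !mulmxA JJ mul1mx.
  have Jw : J *m conjmx w = w *m J by rewrite -{2}wJ -!mulmxA JJ mulmx1.
  rewrite /conj_by !conjmxM !mulmxA Jw -!mulmxA cw.
  by [].
- exact: analytic_subgroup_conj.
Qed.

End DiagramInvolution.

(** * The complex orthogonal groups *)

Section ComplexOrthogonal.
Context (R : realType) (n : nat).
Local Notation C := (R[i]).
Let D := complex_scalars R.
Implicit Types A w X : 'M[C]_n.

Lemma SO_conj w A : w *m w = 1%:M -> w^T *m 1%:M *m w = 1%:M -> SO A ->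
  SO (conj_by w A).
Proof.
rewrite mulmx1 => ww wTw [AA dA]; split.
  rewrite /conj_by !trmx_mul -!mulmxA (mulmxA w^T w) wTw mul1mx (mulmxA A^T).
  by rewrite AA mul1mx.
rewrite /conj_by !det_mulmx dA mulr1.
by rewrite -det_mulmx ww det1.
Qed.

Lemma SO_real_conj w A : w *m w = 1%:M -> adjmx D w = w -> conjmx D w = w ->
  @SO_real R n A -> @SO_real R n (conj_by w A).
Proof.
move=> ww wh wr [B [BB dB] <-].
have [v vw] : exists v : 'M[R]_n, w = map_mx (real_complex R) v.
  exists (map_mx (@complex.Re R) w); apply/matrixP => i j; rewrite !mxE.
  have := congr1 (fun M : 'M[C]_n => M i j) wr; rewrite mxE.
  by case: (w i j) => p q [qq]; congr Complex; lra.
have inj := @map_mx_inj _ _ (real_complex R).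
have vv : v *m v = 1%:M by apply: inj; rewrite map_mxM map_mx1 -vw.
have vT : v^T = v.
  by apply: inj; rewrite -map_trmx -vw -[RHS]wh /adjmx wr.
exists (v *m B *m v); last by rewrite !map_mxM -vw.
split; last by rewrite !det_mulmx dB mulr1 -det_mulmx vv det1.
by rewrite !trmx_mul vT -!mulmxA (mulmxA v v) vv mul1mx (mulmxA B^T) BB mul1mx.
Qed.

End ComplexOrthogonal.

(** * The split orthogonal groups *)

Section SplitOrthogonal.
Context (R : realType) (p : nat).
Local Notation J := (signature_mx R p).
Local Notation D := (real_scalars R).
Implicit Types A w X : 'M[R]_(p + p).

Lemma signature_tr : J^T = J.
Proof. by rewrite /signature_mx tr_block_mx !trmx0 linearN/= !trmx1. Qed.

Lemma signature_sqr : J *m J = 1%:M.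
Proof.
rewrite /signature_mx mulmx_block !mulmx0 !mul0mx !addr0 !add0r mulmx1.
by rewrite mulmxN mulNmx opprK mulmx1 -scalar_mx_block.
Qed.

Lemma conjmx_real m n (A : 'M[R]_(m, n)) : conjmx D A = A.
Proof. exact: map_mx_id. Qed.

Lemma SO_pp_conj w A : w *m w = 1%:M -> w^T *m J *m w = J -> SO_pp A ->
  SO_pp (conj_by w A).
Proof.
move=> ww wJ [AA dA]; split.
  rewrite /conj_by !trmx_mul -!mulmxA (mulmxA J w) (mulmxA w^T (J *m w)).
  rewrite (mulmxA w^T J) wJ (mulmxA J A) (mulmxA A^T (J *m A)) (mulmxA A^T J) AA.
  by rewrite mulmxA.
rewrite /conj_by !det_mulmx dA mulr1.
by rewrite -det_mulmx ww det1.
Qed.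

Lemma SO_pp1 : @SO_pp R p 1%:M.
Proof. by split; rewrite ?det1// trmx1 mulmx1 mul1mx. Qed.

Lemma SOo_pp_sub : @SOo_pp R p `<=` @SO_pp R p.
Proof. exact: connected_component_sub. Qed.

(** The image of the identity component under conjugation is connected, contains 1 and lies in
    [SO_pp], so it stays in that component. *)
Lemma SOo_pp_conj w A : w *m w = 1%:M -> w^T *m J *m w = J -> SOo_pp A ->
  SOo_pp (conj_by w A).
Proof.
move=> ww wJ GA.
apply: (@connected_component_max _ (@SO_pp R p) (conj_by w @` @SOo_pp R p)).
- exists 1%:M; last exact: conj_by1.
  exact/connected_component_refl/SO_pp1.
- by move=> _ [B GB <-]; apply: SO_pp_conj => //; exact: SOo_pp_sub.
- apply: connected_continuous_connected; first exact: component_connected.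
  by apply: continuous_subspaceT => B; exact: continuous_conj_by.
- by exists A.
Qed.

(** The one-parameter group is a connected subset of [SO_pp] through 1, being a continuous image of
    the line. *)
Lemma SOo_pp_exp X : skew_J J X -> lie_algebra idfun (@SOo_pp R p) X.
Proof.
move=> XJ t; pose e (s : R) : 'M[R]_(p + p) :=
  expmx ((idfun : {rmorphism R -> R}) s *: X).
apply: (@connected_component_max _ (@SO_pp R p) (e @` setT)).
- by exists 0 => //; rewrite /e /= scale0r (expmx0 D).
- move=> _ [s _ <-]; split; first exact: (expmx_skew D signature_sqr).
  exact: (det_expmx_skew D signature_sqr).
- apply: connected_continuous_connected.
    by apply/connected_intervalP.
  by apply: continuous_subspaceT => s; exact: (continuous_expmx D).
- by exists t.
Qed.

(** J w J = w makes w block diagonal with symmetric involutive blocks; conjugation by each block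
    preserves SO(p), whatever the sign of its determinant. *)
Lemma SO_times_SO_conj w A : w *m w = 1%:M -> adjmx D w = w ->
  J *m conjmx D w *m J = w -> SO_times_SO A -> SO_times_SO (conj_by w A).
Proof.
rewrite conjmx_real /adjmx conjmx_real => ww wT wJ [B [C [[BB dB] [CC dC] ->]]].
have [w1 [w2 wE]] : exists w1 w2 : 'M[R]_p, w = block_mx w1 0 0 w2.
  exists (ulsubmx w), (drsubmx w).
  move: wJ; rewrite -(submxK w) /signature_mx.
  move: (ulsubmx w) (ursubmx w) (dlsubmx w) (drsubmx w) => w1 a b w2.
  rewrite block_mxKul block_mxKdr !mulmx_block.
  rewrite !(mulmx0, mul0mx, addr0, add0r, mulmx1, mul1mx, mulmxN, mulNmx).
  move=> /eq_block_mx[_ aN bN _].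
  have z (M : 'M[R]_p) : - M = M -> M = 0.
    by move=> /matrixP E; apply/matrixP => i j; have := E i j; rewrite !mxE; lra.
  by rewrite (z _ aN) (z _ bN).
move: ww wT; rewrite wE mulmx_block tr_block_mx !trmx0.
rewrite !(mulmx0, mul0mx, addr0, add0r) scalar_mx_block.
move=> /eq_block_mx[w1K _ _ w2K] /eq_block_mx[w1T _ _ w2T].
have conjSO v (M : 'M[R]_p) : v *m v = 1%:M -> v^T = v -> M^T *m M = 1%:M ->
    \det M = 1 -> SO (conj_by v M).
  move=> vv vT MM dM; split.
    rewrite /conj_by !trmx_mul vT -!mulmxA (mulmxA v v) vv mul1mx (mulmxA M^T).
    by rewrite MM mul1mx.
  by rewrite /conj_by !det_mulmx dM mulr1 -det_mulmx vv det1.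
exists (conj_by w1 B), (conj_by w2 C); split; [exact: conjSO|exact: conjSO|].
by rewrite /conj_by !mulmx_block !(mulmx0, mul0mx, addr0, add0r).
Qed.

End SplitOrthogonal.

Theorem lemma3p2 (R : realType) :
  (forall (j : nat) (a : set 'M[R[i]]_(2 * j))
      (P : set ('M[R[i]]_(2 * j) -> R)) (alpha : nat -> 'M[R[i]]_(2 * j) -> R),
    let iota : {rmorphism R -> R[i]} := real_complex R in
    let G := @SO R[i] (2 * j) in
    let K := @SO_real R (2 * j) in
    let theta := @cartan_theta_C R (2 * j) in
    let g := lie_algebra iota G in
    let N := analytic_subgroup (iwasawa_n iota g a P) in
    (4 <= j)%N ->
    maximal_abelian_in iota (cartan_s iota G theta) a ->
    positive_system iota g a P ->
    D_numbering iota a P j alpha ->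
    exists f : 'M[R[i]]_(2 * j) -> 'M[R[i]]_(2 * j),
      [/\ involutive_automorphism G f,
          forall H, a H ->
            differential_at1 iota f H (diagram_involution a j alpha H),
          (forall A, G A -> f (theta A) = theta (f A)) /\ f @` K = K
        & f @` N = N])
  /\
  (forall (p : nat) (a : set 'M[R]_(p + p))
      (P : set ('M[R]_(p + p) -> R)) (alpha : nat -> 'M[R]_(p + p) -> R),
    let iota : {rmorphism R -> R} := idfun in
    let G := @SOo_pp R p in
    let K := @SO_times_SO R p in
    let theta := @cartan_theta_R R (p + p) in
    let g := lie_algebra iota G in
    let N := analytic_subgroup (iwasawa_n iota g a P) in
    (4 <= p)%N ->
    maximal_abelian_in iota (cartan_s iota G theta) a ->
    positive_system iota g a P ->
    D_numbering iota a P p alpha ->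
    exists f : 'M[R]_(p + p) -> 'M[R]_(p + p),
      [/\ involutive_automorphism G f,
          forall H, a H ->
            differential_at1 iota f H (diagram_involution a p alpha H),
          (forall A, G A -> f (theta A) = theta (f A)) /\ f @` K = K
        & f @` N = N]).
Proof.
split=> [j|p] a P alpha iota G K theta g N r4 amax Ppos num.
- pose D := complex_scalars R; pose J : 'M[R[i]]_(2 * j) := 1%:M.
  have J_tr : J^T = J by exact: trmx1.
  have JJ : J *m J = 1%:M by exact: mulmx1.
  have J_conj : conjmx D J = J by exact: conjmx1.
  have GJ A : G A -> A^T *m J *m A = J by move=> [AA _]; rewrite mulmx1.
  have Gexp X : skew_J J X -> lie_algebra iota G X.
    move=> XJ t; split; last exact: (det_expmx_skew D JJ).
    by have := expmx_skew D JJ t XJ; rewrite mulmx1.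
  have Gtheta A : G A -> theta A = J *m conjmx D A *m J.
    by rewrite mulmx1 mul1mx.
  have Gconj w : w *m w = 1%:M -> w^T *m J *m w = J -> forall A, G A -> G (conj_by w A).
    by move=> ww wJ A; exact: SO_conj.
  have n2 : (2 < 2 * j)%N by rewrite (leq_trans (ltnW r4))// leq_pmull.
  have [w [ww wh wJ [inv dif th fN]]] :=
    diagram_involution_conj J_tr JJ J_conj GJ Gexp Gtheta Gconj n2 r4 amax Ppos num.
  exists (conj_by w); split => //; split => //.
  apply: conj_by_image => // A; apply: SO_real_conj => //.
  by rewrite mulmx1 mul1mx in wJ.
- pose D := real_scalars R; pose J := signature_mx R p.
  have J_tr : J^T = J by exact: signature_tr.
  have JJ : J *m J = 1%:M by exact: signature_sqr.
  have J_conj : conjmx D J = J by exact: conjmx_real.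
  have GJ A : G A -> A^T *m J *m A = J by move=> /SOo_pp_sub[].
  have Gexp X : skew_J J X -> lie_algebra iota G X by exact: SOo_pp_exp.
  have Gtheta A : G A -> theta A = J *m conjmx D A *m J.
    move=> GA; rewrite conjmx_real /theta /cartan_theta_R.
    (* A^T J A = J says that J A J is the inverse of A^T. *)
    have AJ : A^T *m (J *m A *m J) = 1%:M.
      by rewrite !mulmxA GJ.
    have [uA _] := mulmx1_unit AJ.
    by apply: (can_inj (mulKmx uA)); rewrite mulmxV.
  have Gconj w : w *m w = 1%:M -> w^T *m J *m w = J -> forall A, G A -> G (conj_by w A).
    by move=> ww wJ A; exact: SOo_pp_conj.
  have n2 : (2 < p + p)%N by rewrite (leq_trans (ltnW r4))// leq_addr.
  have [w [ww wh wJ [inv dif th fN]]] :=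
    diagram_involution_conj J_tr JJ J_conj GJ Gexp Gtheta Gconj n2 r4 amax Ppos num.
  exists (conj_by w); split => //; split => //.
  by apply: conj_by_image => // A; exact: SO_times_SO_conj.
Qed.
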